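(* Let $(G,K)=(\mathrm{Sp}_{2n}(\mathbb C),\mathrm{GL}_n(\mathbb C))$ (symmetric pair of type CI), and let $P=P_S\subset G$, $Q=Q_T\subset K$ be parabolic subgroups with $S\subset\{\alpha_1,\dots,\alpha_n\}$, $T\subset\{\beta_1,\dots,\beta_{n-1}\}$ in the notation of the context. The double flag variety $K/Q\times G/P$ has finitely many $K$-orbits (for the diagonal action) in each of the following cases: (a) $S=\{\alpha_1\}$ or $S=\{\alpha_n\}$, and $T$ is any subset; (b) $S=\{\alpha_i\}$ and $T=\{\beta_j\}$, for any $i,j$.
   Context: $\mathrm{GL}_n$ is embedded in $\mathrm{Sp}_{2n}$ as the subgroup stabilizing both summands of a polarization $\mathbb C^{2n}=V^+\oplus V^-$ into Lagrangian subspaces. For $S=\{\alpha_{i_1},\dots,\alpha_{i_k}\}$ with $i_1<\dots<i_k$, $P_S\subset\mathrm{Sp}_{2n}$ is the stabilizer of a flag of isotropic subspaces of dimensions $i_1<\dots<i_k\le n$. For $T=\{\beta_{j_1},\dots,\beta_{j_l}\}$, $Q_T\subset\mathrm{GL}_n$ is the stabilizer of a flag of subspaces of $\mathbb C^n$ of dimensions $j_1<\dots<j_l$. Equivalently, $S$ and $T$ are the complements $\Pi\setminus J$ of the sets of simple roots generating the Levi parts, with standard numbering ($\alpha_n$ the long root). *)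

(* Defs.v *)
From HB Require Import structures.
From mathcomp Require Import all_boot all_order all_algebra.
From mathcomp Require Import complex.
From mathcomp Require Import all_classical all_reals.

Set Implicit Arguments.
Unset Strict Implicit.
Unset Printing Implicit Defensive.

Import Order.TTheory GRing.Theory Num.Theory.
Local Open Scope classical_set_scope.
Local Open Scope ring_scope.

(* Homogeneous spaces and orbits for matrix groups. 'M[C]_m carries no
   library group structure, so groups are plain sets of matrices. *)
Section Cosets.
Variables (F : fieldType) (m : nat).
Implicit Types (G H K : set 'M[F]_m) (g k : 'M[F]_m).

(* g A; for a subgroup H this is the left coset g H *)
Definition ltranslate g (A : set 'M[F]_m) : set 'M[F]_m :=
  [set g *m a | a in A].

(* G / H *)
Definition quotient_space G H : set (set 'M[F]_m) :=
  [set ltranslate g H | g in G].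

(* K / Q x G / P *)
Definition double_flag_variety K Q G P : set (set 'M[F]_m * set 'M[F]_m) :=
  quotient_space K Q `*` quotient_space G P.

Definition diag_orbit K (x : set 'M[F]_m * set 'M[F]_m) :
    set (set 'M[F]_m * set 'M[F]_m) :=
  [set (ltranslate k x.1, ltranslate k x.2) | k in K].

Definition finitely_many_orbits K (X : set (set 'M[F]_m * set 'M[F]_m)) :=
  finite_set [set diag_orbit K x | x in X].

End Cosets.

Section Symplectic.
Variables (F : fieldType) (n : nat).
Implicit Types (g : 'M[F]_(n + n)) (U V : {vspace 'cV[F]_(n + n)}).

Definition sympl_mx : 'M[F]_(n + n) := block_mx 0 1%:M (- 1%:M) 0.

Definition Sp : set 'M[F]_(n + n) :=
  [set g | g^T *m sympl_mx *m g = sympl_mx].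

(* g acts on column vectors by v |-> g v. Since g is invertible wherever this
   is used, g U <= U amounts to g U = U. *)
Definition stabilizes g U : Prop := (linfun (mulmx g) @: U <= U)%VS.

Definition isotropic U : Prop :=
  forall u v, u \in U -> v \in U -> u^T *m sympl_mx *m v = 0.

Definition lagrangian U : Prop := isotropic U /\ \dim U = n.

Definition polarization U V : Prop :=
  [/\ lagrangian U, lagrangian V, (U :&: V = 0)%VS & (U + V = fullv)%VS].

(* GL_n inside Sp_2n: restriction to Vp identifies it with GL(Vp), Vp playing
   the role of the standard representation C^n. *)
Definition GL_polar Vp Vm : set 'M[F]_(n + n) :=
  [set g | [/\ Sp g, stabilizes g Vp & stabilizes g Vm]].

(* A flag with set of dimensions D; only the members E d with d in D matter. *)
Definition is_flag (D : set nat) (E : nat -> {vspace 'cV[F]_(n + n)}) : Prop :=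
  (forall d, D d -> \dim (E d) = d) /\
  (forall d e, D d -> D e -> (d <= e)%N -> (E d <= E e)%VS).

Definition isotropic_flag D E : Prop :=
  is_flag D E /\ forall d, D d -> isotropic (E d).

Definition flag_in V D E : Prop :=
  is_flag D E /\ forall d, D d -> (E d <= V)%VS.

Definition flag_stabilizer (G : set 'M[F]_(n + n)) (D : set nat)
    (E : nat -> {vspace 'cV[F]_(n + n)}) : set 'M[F]_(n + n) :=
  [set g | G g /\ forall d, D d -> stabilizes g (E d)].

End Symplectic.

Arguments Sp : clear implicits.

(* Main.v *)
Require Import Defs.
From mathcomp Require Import all_boot all_order all_algebra.
From mathcomp Require Import boolp zify.

(** Write M^o for the orthogonal of M under the symplectic form. Orbits of K
    on K/Q x G/P are orbits of Q on the isotropic subspaces U = g E_i, so it is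
    enough to attach to every such U an element of a finite set that determines
    U up to Q ([finite_orbits_of_codes]). Two ideas do this.

    From isometries to linear maps. Let g be invertible, with adjoint g*. If g
    maps A to A' and A^o to A'^o, then g* g maps A to itself. Over the complex
    numbers g* g has a square root c that is a polynomial in g* g; hence c is
    self-adjoint and preserves A, and k = g c^-1 is an isometry with k A = A'.
    The choice of k does not depend on A ([symplectize]). Applied to A = V+, V-,
    the members F_d of the flag, and U, this reduces the classification under Q
    to one under linear maps. Moreover linear maps of V+ and V- can be extended
    from subspaces ([extend_to_summand]), so U and U' are conjugate under Q as
    soon as a linear isomorphism from U^o to U'^o carries U to U' and matches the
    traces on U^o and U'^o of the subspaces F_d + V- and (F_d^o :&: V-) + V+
    ([flag_fixing_isometry]). When U is Lagrangian, U^o = U carries just two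
    flags; when the flag is a single subspace W, U^o carries two flags with two
    proper members each and the subspace U, a configuration of type E6.

    Normal forms in linear algebra. Let the vectors of a basis be labelled by a
    preorder in which no three elements are pairwise incomparable, and allow the
    elementary moves that add to a basis vector multiples of smaller ones. Then
    every subspace Y becomes spanned by vectors e_a and e_a + e_b, with a and b
    incomparable and all these pieces disjoint ([pair_adapt]). Elementary moves
    among the pieces, for the order by generated down-sets, are induced by moves
    of the basis ([reach_lift]), so the argument can be repeated inside Y. For a
    chain all pieces are single vectors, and one recovers bases adapted to two
    flags ([adapt_two_flags]). For a chain and one more subspace the order is a
    product of two chains, one of length two, and has width two; with a chain of
    length three the order by down-sets, J(2 x 3), still has width two, which is
    the E6 case ([adapt_two_flags_subspace]). In all cases a finite amount of
    combinatorial data determines the configuration up to isomorphism.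

    When E_i is a line spanned by v + w, with v in V+ and w in V-, one classifies
    in V+ the flag together with the line of v and the hyperplane orthogonal to w.
    A linear map of V+ matching these is extended to K by duality on V-, and
    a rescaling, for which a square root is extracted, makes it match the lines
    spanned by v + w ([finite_line]). *)

Set Implicit Arguments.
Unset Strict Implicit.
Unset Printing Implicit Defensive.

Import Order.TTheory GRing.Theory Num.Theory.
Local Open Scope ring_scope.

(** * Elementary moves of families of vectors *)

Section Families.
Variables (F : fieldType) (V : vectType F).

Lemma addvCA (A B C : {vspace V}) : (A + (B + C) = B + (A + C))%VS.
Proof. by rewrite addvA [(A + B)%VS]addvC -addvA. Qed.

Definition span_on (I : finType) (e : I -> V) (A : {set I}) : {vspace V} :=
  (\sum_(i in A) <[e i]>)%VS.

Definition sum_on (I : finType) (e : I -> V) (s : {set I}) : V :=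
  \sum_(i in s) e i.

Lemma mem_span_on (I : finType) (e : I -> V) (A : {set I}) i :
  i \in A -> e i \in span_on e A.
Proof. by move=> iA; rewrite memvE; apply: (sumv_sup i). Qed.

Lemma span_on_subP (I : finType) (e : I -> V) (A : {set I}) (W : {vspace V}) :
  reflect (forall i, i \in A -> e i \in W) (span_on e A <= W)%VS.
Proof.
apply: (iffP subv_sumP) => h i iA; first by rewrite memvE; apply: h.
by rewrite -memvE; apply: h.
Qed.

Lemma span_onP (I : finType) (e : I -> V) (A : {set I}) v :
  v \in span_on e A -> exists k : I -> F, v = \sum_(i in A) k i *: e i.
Proof.
case/memv_sumP => vs h ->.
have /choice [k kP] : forall i, exists k, i \in A -> vs i = k *: e i.
  move=> i; case: (boolP (i \in A)) => iA; last by exists 0.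
  by have /vlineP [k ->] := h i iA; exists k.
by exists k; apply: eq_bigr => i iA; apply: kP.
Qed.

Lemma eq_span_on (I : finType) (e e' : I -> V) (A : {set I}) :
  (forall i, i \in A -> e i = e' i) -> span_on e A = span_on e' A.
Proof. by move=> h; apply: eq_bigr => i /h ->. Qed.

Lemma limg_span_on (I : finType) (e e' : I -> V) (A : {set I}) (f : 'End(V)) :
  (forall i, i \in A -> f (e i) = e' i) -> (f @: span_on e A)%VS = span_on e' A.
Proof.
by move=> h; rewrite limg_sum; apply: eq_bigr => i iA; rewrite limg_line h.
Qed.

Definition upd (I : finType) (e : I -> V) c v : I -> V :=
  fun i => if i == c then v else e i.

(** Moves add to the vector indexed by c a multiple of one indexed by a, for
    r a c, or rescale a vector; they are undone by moves of the same kind. *)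
Inductive reach (I : finType) (r : rel I) : (I -> V) -> (I -> V) -> Prop :=
| reach_refl e : reach r e e
| reach_add e e' a c t :
    a != c -> r a c -> reach r (upd e c (e c + t *: e a)) e' -> reach r e e'
| reach_scale e e' a t :
    t != 0 -> reach r (upd e a (t *: e a)) e' -> reach r e e'.

Section Reach.
Variable I : finType.
Implicit Types (r : rel I) (e : I -> V).

Lemma reach_trans r e1 e2 e3 : reach r e1 e2 -> reach r e2 e3 -> reach r e1 e3.
Proof.
elim=> [e|e e' a c t ac rac _ ih|e e' a t t0 _ ih] // /ih h.
  exact: reach_add ac rac h.
exact: reach_scale t0 h.
Qed.

Lemma reach_add1 r e a c t :
  a != c -> r a c -> reach r e (upd e c (e c + t *: e a)).
Proof. by move=> ac rac; apply: reach_add ac rac (reach_refl _ _). Qed.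

Lemma reach_scale1 r e a t : t != 0 -> reach r e (upd e a (t *: e a)).
Proof. by move=> t0; apply: reach_scale t0 (reach_refl _ _). Qed.

Lemma reach_sub r r' e e' : subrel r r' -> reach r e e' -> reach r' e e'.
Proof.
move=> sub; elim=> [{}e|{}e {}e' a c t ac rac _ ih|{}e {}e' a t t0 _ ih].
- exact: reach_refl.
- exact: reach_add ac (sub _ _ rac) ih.
- exact: reach_scale t0 ih.
Qed.

(** A move only adds vectors of smaller index, so spans over down-sets of r do
    not change. *)
Lemma reach_span r e e' (D : {set I}) :
  (forall a c, r a c -> c \in D -> a \in D) ->
  reach r e e' -> span_on e D = span_on e' D.
Proof.
move=> dD; elim=> [//|{}e {}e' a c t ac rac _ <-|{}e {}e' a t t0 _ <-];
  apply/eqP; rewrite eqEsubv; apply/andP; split; apply/span_on_subP => i iD.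
- have [E|ic] := eqVneq i c; last first.
    by have := mem_span_on (upd e c (e c + t *: e a)) iD; rewrite /upd (negPf ic).
  rewrite E in iD *.
  have := mem_span_on (upd e c (e c + t *: e a)) iD.
  have := mem_span_on (upd e c (e c + t *: e a)) (dD _ _ rac iD).
  rewrite /upd eqxx (negPf ac) => ha hc.
  by have := rpredB hc (memvZ t ha); rewrite addrK.
- rewrite /upd; case: eqVneq => [E|_]; last exact: mem_span_on.
  by rewrite E in iD; rewrite rpredD ?rpredZ ?mem_span_on // (dD _ _ rac).
- have := mem_span_on (upd e a (t *: e a)) iD; rewrite /upd.
  case: eqVneq => [->|//] h.
  by have := memvZ t^-1 h; rewrite scalerA mulVf // scale1r.
- rewrite /upd; case: eqVneq => [E|_]; last exact: mem_span_on.
  by rewrite E in iD; rewrite rpredZ ?mem_span_on.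
Qed.

(** Inclusion of the down-sets generated by t and s. *)
Definition dominated r (t s : {set I}) : bool :=
  [forall b in t, exists a in s, r b a].

Lemma sum_on_upd e c v (s : {set I}) :
  sum_on (upd e c v) s = if c \in s then sum_on e s + (v - e c) else sum_on e s.
Proof.
rewrite /sum_on /upd; case: ifP => cs; last first.
  by apply: eq_bigr => i is_; case: eqVneq => // E; rewrite -E is_ in cs.
rewrite !(bigD1 c cs) /= eqxx addrC [e c + _]addrC -addrA subrKC.
by congr (_ + _); apply: eq_bigr => i /andP[_ /negPf ->].
Qed.

(** Each e_b with b in t is added, with coefficient k, to some e_a with a in s
    above b; as s is disjoint from t, the vectors that are added stay unchanged
    in the process. *)
Lemma lift_add r e (s t : {set I}) k :
  [disjoint s & t] -> dominated r t s ->
  exists2 e', reach r e e' &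
    sum_on e' s = sum_on e s + k *: sum_on e t /\ forall i, i \notin s -> e' i = e i.
Proof.
move=> st /forall_inP dom.
suff H (bs : seq I) : {subset bs <= t} -> exists2 e', reach r e e' &
    sum_on e' s = sum_on e s + k *: (\sum_(b <- bs) e b)
    /\ forall i, i \notin s -> e' i = e i.
  have [|e' ee' [h1 h2]] := H (enum t); first by move=> i; rewrite mem_enum.
  by exists e' => //; split=> //; rewrite h1 /sum_on big_enum.
elim: bs => [|b bs ih] sub.
  exists e; first exact: reach_refl.
  by split=> //; rewrite big_nil scaler0 addr0.
have [|e1 ee1 [h1 h2]] := ih; first by move=> i ib; apply: sub; rewrite inE ib orbT.
have bt : b \in t by apply: sub; rewrite inE eqxx.
have /exists_inP [a as_ rba] := dom b bt.
have bs_ : b \notin s by rewrite (disjointFl st bt).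
have ba : b != a by apply: contraNneq bs_ => ->.
exists (upd e1 a (e1 a + k *: e1 b)); first exact: reach_trans ee1 (reach_add1 _ _ ba rba).
split=> [|i is_].
  rewrite sum_on_upd as_ h1 big_cons (h2 b) //.
  by rewrite [e1 a + _]addrC addrK scalerDr -!addrA [k *: e b + _]addrC.
by rewrite /upd (h2 i) //; case: eqVneq => // E; rewrite -E (negPf is_) in as_.
Qed.

Lemma lift_scale r e (s : {set I}) k : k != 0 ->
  exists2 e', reach r e e' &
    sum_on e' s = k *: sum_on e s /\ forall i, i \notin s -> e' i = e i.
Proof.
move=> k0.
suff H (bs : seq I) : uniq bs -> exists2 e', reach r e e' &
    forall i, e' i = if i \in bs then k *: e i else e i.
  have [|e' ee' h] := H (enum s); first exact: enum_uniq.
  exists e' => //; split=> [|i /negPf is_]; last by rewrite h mem_enum is_.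
  by rewrite /sum_on scaler_sumr; apply: eq_bigr => i is_; rewrite h mem_enum is_.
elim: bs => [_|b bs ih /andP[nb ub]]; first by exists e => //; apply: reach_refl.
have [e1 ee1 h1] := ih ub.
exists (upd e1 b (k *: e1 b)); first exact: reach_trans ee1 (reach_scale1 _ _ _ k0).
move=> i; by rewrite /upd inE !h1 (negPf nb); case: eqVneq => [->|_].
Qed.

(** Moves on the sums over disjoint blocks are induced by moves on the family
    itself: disjointness makes sure that the other sums do not change. *)
Lemma reach_lift r (C : {set {set I}}) e (y y' : {set I} -> V) :
  trivIset C ->
  {in C, forall s, y s = sum_on e s} ->
  reach (fun t s => [&& dominated r t s, t \in C & s \in C]) y y' ->
  exists2 e', reach r e e' & {in C, forall s, y' s = sum_on e' s}.
Proof.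
move=> /trivIsetP dis hy R; elim: R e hy => [{}y|{}y {}y' t s k ts /and3P[dom tC sC] _ ih|
    {}y {}y' s k k0 _ ih] e hy.
- by exists e => //; apply: reach_refl.
- have [|e1 ee1 [h1 h2]] := lift_add e k _ dom.
    by apply: dis => //; rewrite eq_sym.
  have [|e2 e12 h] := ih e1; last by exists e2 => //; apply: reach_trans e12.
  move=> u uC; rewrite /upd; case: eqVneq => [->|us]; first by rewrite h1 !hy.
  rewrite hy //; apply: eq_bigr => i iu; rewrite h2 //.
  by rewrite (disjointFr (dis _ _ uC sC us)).
- have [sC|sC] := boolP (s \in C); last first.
    apply: ih => u uC; rewrite /upd; case: eqVneq => [E|_]; last exact: hy.
    by rewrite -E uC in sC.
  have [e1 ee1 [h1 h2]] := lift_scale r e s k0.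
  have [|e2 e12 h] := ih e1; last by exists e2 => //; apply: reach_trans e12.
  move=> u uC; rewrite /upd; case: eqVneq => [->|us]; first by rewrite h1 !hy.
  rewrite hy //; apply: eq_bigr => i iu; rewrite h2 //.
  by rewrite (disjointFr (dis _ _ uC sC us)).
Qed.


Definition rel_on r (B : {set I}) : rel I := fun a c => [&& r a c, a \in B & c \in B].

(** As the elements may coincide, this is the usual condition for a reflexive
    relation r. *)
Definition width_le2 r (B : {set I}) : Prop :=
  {in B & &, forall a b c, [|| r a b, r b a, r a c, r c a, r b c | r c b]}.

Definition piece r (s : {set I}) : Prop :=
  (exists a, s = [set a]) \/ exists a b, [/\ s = [set a; b], ~~ r a b & ~~ r b a].

Lemma span_on_shear (f : I -> V) (C : {set I}) s s0 k :
  s0 \in C -> s0 != s ->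
  span_on f C = span_on (upd f s (f s + k *: f s0)) C.
Proof.
move=> s0C ne; apply: (@reach_span (fun a _ => a \in C)) => //.
exact: reach_add1.
Qed.
End Reach.

(** * Normal form of a subspace for an order of width two *)

Section Adapt.
Variables (I : finType) (r : rel I).
Hypotheses (rr : reflexive r) (rt : transitive r).
Variable B : {set I}.
Hypothesis wB : width_le2 r B.

Definition shifted (e : I -> V) (h : {set I} -> F) a : {set I} -> V :=
  fun s => sum_on e s + h s *: e a.

Definition concentrated (a : I) (D : {set I}) (C : {set {set I}})
    (Y : {vspace V}) (e : I -> V) : Prop :=
  exists (e' : I -> V) (h' : {set I} -> F),
  [/\ reach (rel_on r B) e e', {in a |: D, e =1 e'},
    Y = (span_on (shifted e' h' a) C + span_on e' D)%VS &
    {in C, forall s, h' s = 0} \/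
    exists s0 c, [/\ s0 \in C, s0 = [set c], ~~ r a c, ~~ r c a &
       h' s0 != 0 /\ {in C, forall s, s != s0 -> h' s = 0}]].

(** The coefficients h of e_a are removed one at a time. A piece s containing
    some c above a absorbs h s e_a into e_c. By the width condition the other
    pieces with nonzero coefficient are singletons, whose elements are
    incomparable to a and hence comparable to each other; of two of them, the
    larger is cleared by subtracting a multiple of the smaller. *)
Lemma concentrate (a : I) (D : {set I}) (C : {set {set I}}) (e : I -> V) h (Y : {vspace V}) :
  a \in B -> a \notin D -> D \subset B ->
  (forall c, c \in B -> c \notin a |: D -> r c a -> r a c) ->
  trivIset C -> {in C, forall s : {set I}, s \subset B :\: (a |: D) /\ piece r s} ->
  Y = (span_on (shifted e h a) C + span_on e D)%VS ->
  concentrated a D C Y e.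
Proof.
move=> aB aD DB inv /trivIsetP dis hC.
have [n] := ubnP #|[set s in C | h s != 0]|.
elim: n e h => // n ih e h; rewrite ltnS => hn EY.
have notDa (s : {set I}) c : s \in C -> c \in s -> c \in B /\ c \notin a |: D.
  move=> sC cs; have [/subsetP sub _] := hC s sC.
  by have := sub c cs; rewrite inE => /andP[].
(* A step that cancels one coefficient and only changes e_c allows to conclude
   by induction. *)
have reduce s c e1 h1 : s \in C -> h s != 0 -> c \in s ->
    h1 = (fun u => if u == s then 0 else h u) -> 
    reach (rel_on r B) e e1 -> (forall i, i != c -> e i = e1 i) ->
    Y = (span_on (shifted e1 h1 a) C + span_on e1 D)%VS ->
    concentrated a D C Y e.
  move=> sC hs cs Eh1 ee1 eqe1 EY1.
  have [|e2 [h2 [e12 eqe2 EY2 H]]] := ih e1 h1 _ EY1.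
    apply: leq_trans hn; apply: proper_card; apply/properP; split.
      apply/subsetP => u; rewrite !inE Eh1; case: (u == s); rewrite ?eqxx ?andbF //.
    by exists s; rewrite !inE ?sC // Eh1 !eqxx.
  exists e2, h2; split=> //; first exact: reach_trans ee1 e12.
  move=> i iD; rewrite -eqe2 // eqe1 //; apply: contraTneq iD => ->.
  by have [] := notDa s c sC cs.
case: (pselect (exists s c, [/\ s \in C, h s != 0, c \in s & r a c])) => [|N1].
  move=> [s [c [sC hs cs rac]]]; have [cB] := notDa s c sC cs.
  rewrite !inE negb_or => /andP[ca cD].
  have ac : a != c by rewrite eq_sym.
  apply: (reduce s c (upd e c (e c + h s *: e a)) _ sC hs cs erefl).
  - by apply: reach_add1 => //; rewrite /rel_on rac aB.
  - by move=> i /negPf; rewrite /upd => ->.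
  - rewrite EY; congr (_ + _)%VS; apply: eq_span_on => u uC; last first.
      by rewrite /upd; case: eqVneq => // E; rewrite -E uC in cD.
    rewrite /shifted sum_on_upd /upd (negPf ac).
    have [->|us] := eqVneq u s.
      by rewrite cs scale0r addr0 addrAC subrr add0r.
    by rewrite (disjointFl (dis _ _ uC sC us) cs).
have sing s : s \in C -> h s != 0 -> exists c, [/\ s = [set c], ~~ r a c & ~~ r c a].
  move=> sC hs.
  have nr c : c \in s -> ~~ r a c /\ ~~ r c a.
    move=> cs; have nac : ~~ r a c by apply/negP => rac; apply: N1; exists s, c.
    by split=> //; have [cB cD] := notDa s c sC cs; apply: contra nac; apply: inv.
  have [_ [[c Es]|[c [d [Es cd dc]]]]] := hC s sC.
    by exists c; split=> //; apply nr; rewrite Es inE.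
  have [cs ds] : c \in s /\ d \in s by rewrite Es !inE !eqxx orbT.
  have := wB aB (notDa _ _ sC cs).1 (notDa _ _ sC ds).1.
  have [/negPf-> /negPf->] := nr c cs; have [/negPf-> /negPf->] := nr d ds.
  by rewrite (negPf cd) (negPf dc).
case: (pselect (exists s s0, [/\ s \in C, s0 \in C, s0 != s & h s != 0 /\ h s0 != 0])).
  move=> [s [s0 [sC s0C ne [hs hs0]]]].
  wlog : s s0 sC s0C ne hs hs0 / exists c c0, [/\ s = [set c], s0 = [set c0] & r c0 c].
    move=> W.
    have [c [Es ac ca]] := sing s sC hs; have [c0 [Es0 ac0 c0a]] := sing s0 s0C hs0.
    have cs : c \in s by rewrite Es inE.
    have cs0 : c0 \in s0 by rewrite Es0 inE.
    have := wB aB (notDa _ _ sC cs).1 (notDa _ _ s0C cs0).1.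
    rewrite (negPf ac) (negPf ca) (negPf ac0) (negPf c0a) /= => /orP[rc|rc].
      by apply: (W s0 s) => //; [rewrite eq_sym | exists c0, c].
    by apply: (W s s0) => //; exists c, c0.
  move=> [c [c0 [Es Es0 rc]]].
  have cs : c \in s by rewrite Es inE.
  have cs0 : c0 \in s0 by rewrite Es0 inE.
  have [cB] := notDa s c sC cs; rewrite !inE negb_or => /andP[ca cD].
  have [c0B c0D] := notDa s0 c0 s0C cs0.
  have c0c : c0 != c by apply: contraNneq ne; rewrite Es Es0 => ->.
  have [k kh] : exists k, k * h s0 = - h s.
    by exists (- (h s / h s0)); rewrite mulNr divfK.
  apply: (reduce s c (upd e c (e c + k *: e c0)) _ sC hs cs erefl).
  - by apply: reach_add1 => //; rewrite /rel_on rc c0B.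
  - by move=> i /negPf; rewrite /upd => ->.
  - rewrite EY (span_on_shear _ k s0C ne); congr (_ + _)%VS; apply: eq_span_on => u uC; last first.
      by rewrite /upd; case: eqVneq => // E; rewrite -E uC in cD.
    rewrite /upd /shifted sum_on_upd /upd [a == c]eq_sym (negPf ca).
    have [->|us] := eqVneq u s; last by rewrite (disjointFl (dis _ _ uC sC us) cs).
    rewrite cs scale0r addr0 [e c + _]addrC addrK -addrA; congr (_ + _).
    rewrite scalerDr scalerA kh [- _ *: e a]scaleNr addrCA subrr addr0 Es0.
    by rewrite /sum_on big_set1.
move=> N2; exists e, h; split=> //; first exact: reach_refl.
case: (pselect (exists2 s, s \in C & h s != 0)) => [[s sC hs]|N3].
  right; have [c [Es ac ca]] := sing s sC hs; exists s, c; split=> //; split=> // u uC us.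
  by apply/eqP; apply: contraTT isT => hu; case: N2; exists u, s; rewrite eq_sym.
by left => s sC; apply/eqP; apply: contraTT isT => hs; case: N3; exists s.
Qed.

Lemma maximal_elt (D : {set I}) : D != set0 ->
  exists2 a, a \in D & forall b, b \in D -> r a b -> r b a.
Proof.
case/set0Pn => a0 a0D.
have [a aD amax] := @arg_maxnP _ a0 [in D] (fun a => #|[set c in D | r c a]|) a0D.
exists a => // b bD rab.
have sub : [set c in D | r c a] \subset [set c in D | r c b].
  by apply/subsetP => c; rewrite !inE => /andP[-> /rt]; apply.
have /eqP E : [set c in D | r c a] == [set c in D | r c b].
  by rewrite eqEcard sub; apply: amax.
have : b \in [set c in D | r c b] by rewrite inE bD rr.
by rewrite -E inE => /andP[].
Qed.

Lemma span_on_setU1 (J : finType) (f : J -> V) a (D : {set J}) :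
  span_on f (a |: D) = (<[f a]> + span_on f D)%VS.
Proof.
have [aD|aD] := boolP (a \in D); last by rewrite /span_on big_setU1.
rewrite (_ : a |: D = D); last by apply/setUidPr; rewrite sub1set.
by apply/esym/addv_idPr; rewrite -memvE mem_span_on.
Qed.

(** Induction on the number m of treated indices: D contains those not yet
    treated, and Y is described modulo their span. The next index a is a maximal
    element of D, so that e_a may be added to any treated e_c with c comparable
    to a. If e_a lies in Y modulo the rest, it becomes a new piece; otherwise
    every piece has a well-defined coefficient along e_a, and what remains of
    these after [concentrate] merges a with one singleton. *)
Lemma pair_adapt_partial (e : I -> V) (Y : {vspace V}) m :
  (Y <= span_on e B)%VS -> (m <= #|B|)%N ->
  exists (D : {set I}) (e' : I -> V) (C : {set {set I}}),
  [/\ D \subset B, (#|D| + m)%N = #|B|,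
      forall c d, c \in B -> c \notin D -> d \in D -> r c d -> r d c,
      reach (rel_on r B) e e' &
  [/\ trivIset C, {in C, forall s : {set I}, s \subset B :\: D /\ piece r s} &
      (Y + span_on e' D = span_on (sum_on e') C + span_on e' D)%VS]].
Proof.
move=> YB; elim: m => [_|m ih mB].
  exists B, e, set0; split; rewrite ?addn0 //; first by move=> c d ->.
    exact: reach_refl.
  split; first by apply/trivIsetP => A; rewrite inE.
    by move=> s; rewrite inE.
  by rewrite {2}/span_on big_set0 add0v; apply/addv_idPr.
have [D [e1 [C [DB cD inv ee1 [tC hC EY]]]]] := ih (ltnW mB).
have D0 : D != set0.
  by rewrite -card_gt0; move: mB; rewrite -cD -addn1 addnC leq_add2r.
have [a aD amax] := maximal_elt D0.
have aB := subsetP DB a aD.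
pose D' := D :\ a.
have DE : D = a |: D' by rewrite setD1K.
have aD' : a \notin D' by rewrite !inE eqxx.
have D'B : D' \subset B by apply: subset_trans DB; rewrite subD1set.
have inv' c d : c \in B -> c \notin D' -> d \in D' -> r c d -> r d c.
  move=> cB; rewrite !inE negb_and negbK => /orP[/eqP->|cD'] /andP[_ dD].
    exact: amax.
  exact: inv.
have cD1 : (#|D'| + m.+1)%N = #|B|.
  by rewrite -cD (cardsD1 a D) aD -addSnnS add1n.
have sub_D (s : {set I}) : s \subset B :\: D -> s \subset B :\: D'.
  move=> h; apply: subset_trans h _; apply: setDS; exact: subD1set.
have aBD : a \in B :\: D' by rewrite inE aD' aB.
have Dspan : span_on e1 D = (<[e1 a]> + span_on e1 D')%VS by rewrite DE span_on_setU1.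
case: (boolP (e1 a \in (Y + span_on e1 D')%VS)) => [ha|ha].
  exists D', e1, ([set a] |: C); split=> //; split.
  - apply/trivIsetP => s t; rewrite !inE => /orP[/eqP->|sC] /orP[/eqP->|tC'];
      rewrite ?eqxx // => ne.
    + rewrite disjoints1; have [/subsetP sub _] := hC _ tC'.
      by apply: contraL aD => /sub; rewrite inE => /andP[].
    + rewrite disjoint_sym disjoints1; have [/subsetP sub _] := hC _ sC.
      by apply: contraL aD => /sub; rewrite inE => /andP[].
    + exact: (trivIsetP tC).
  - move=> s; rewrite inE => /orP[|sC].
      by rewrite inE => /eqP->; split; [rewrite sub1set | left; exists a].
    by have [h1 h2] := hC _ sC; split=> //; apply: sub_D.
  - rewrite span_on_setU1 /sum_on big_set1 -/(sum_on e1) [(<[_]> + _)%VS]addvC -addvA.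
    rewrite -Dspan -EY Dspan addvCA.
    by apply/esym/addv_idPr; rewrite -memvE.
have [h hP] : exists h : {set I} -> F, forall s, s \in C ->
    sum_on e1 s + h s *: e1 a \in (Y + span_on e1 D')%VS.
  suff /choice [h hP] : forall s, exists k, s \in C ->
      sum_on e1 s + k *: e1 a \in (Y + span_on e1 D')%VS by exists h.
  move=> s; case: (boolP (s \in C)) => sC; last by exists 0.
  have : sum_on e1 s \in (Y + span_on e1 D)%VS.
    by rewrite EY; apply: (subvP (addvSl _ _)); apply: mem_span_on.
  rewrite Dspan addvCA => /memv_addP[_ /vlineP[k ->] [y yY ->]].
  by exists (- k) => _; rewrite scaleNr addrAC subrr add0r.
have EY' : (Y + span_on e1 D')%VS =
    (span_on (shifted e1 h a) C + span_on e1 D')%VS.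
  apply/eqP; rewrite eqEsubv; apply/andP; split; last first.
    rewrite subv_add addvSr andbT; apply/span_on_subP => s sC; exact: hP.
  apply/subvP => y yY.
  have : y \in (span_on (sum_on e1) C + span_on e1 D)%VS.
    rewrite -EY; apply: subvP yY; apply: addvS => //.
    by rewrite Dspan addvSr.
  rewrite Dspan => /memv_addP[_ /span_onP[k ->] [_ /memv_addP[_ /vlineP[t ->] [z zD ->]] Ey]].
  pose y1 := \sum_(s in C) k s *: shifted e1 h a s.
  have y1Y : y1 \in (span_on (shifted e1 h a) C + span_on e1 D')%VS.
    apply: (subvP (addvSl _ _)); apply: memv_suml => s sC.
    by apply: memvZ; apply: mem_span_on.
  have y1Y' : y1 \in (Y + span_on e1 D')%VS.
    by apply: memv_suml => s sC; apply: memvZ; apply: hP.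
  have E : y = y1 + z + (t - \sum_(s in C) k s * h s) *: e1 a.
    have -> : y1 = \sum_(s in C) k s *: sum_on e1 s + (\sum_(s in C) k s * h s) *: e1 a.
      rewrite scaler_suml -big_split /=; apply: eq_bigr => s _.
      by rewrite /shifted scalerDr scalerA.
    rewrite Ey scalerBl; move: (_ *: e1 a) (_ *: e1 a) => T S.
    rewrite -!addrA; congr (_ + _).
    by rewrite [RHS]addrCA addrC; congr (_ + _); rewrite addrC subrK.
  have zY : z \in (Y + span_on e1 D')%VS by apply: (subvP (addvSr _ _)).
  have : (t - \sum_(s in C) k s * h s) *: e1 a \in (Y + span_on e1 D')%VS.
    have -> : (t - \sum_(s in C) k s * h s) *: e1 a = y - (y1 + z).
      by rewrite E [y1 + z + _]addrC addrK.
    by apply: memvB => //; apply: memvD.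
  have [E0|nz] := eqVneq (t - \sum_(s in C) k s * h s) 0.
    rewrite E0 scale0r addr0 in E => _; rewrite E; apply: memvD => //.
    exact: (subvP (addvSr _ _)).
  by move/(memvZ (t - \sum_(s in C) k s * h s)^-1); rewrite scalerA mulVf // scale1r (negPf ha).
have [||e2 [h2 [e12 eqe2 EY2 H]]] := @concentrate a D' C e1 h _ aB aD' D'B _ tC _ EY'.
- by move=> c cB; rewrite -DE => cD'; apply: inv.
- by rewrite -DE.
have eqD' : span_on e2 D' = span_on e1 D'.
  by apply: eq_span_on => i iD'; rewrite eqe2 // inE iD' orbT.
rewrite -eqD' in EY2.
have ee2 := reach_trans ee1 e12.
case: H => [h0|[s0 [c [s0C Es0 nac nca [hs0 h0]]]]].
  exists D', e2, C; split=> //; split=> //.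
    by move=> s sC; have [h1 h3] := hC _ sC; split=> //; apply: sub_D.
  rewrite EY2; congr (_ + _)%VS; apply: eq_span_on => s sC.
  by rewrite /shifted h0 // scale0r addr0.
(* the remaining coefficient is normalized to 1, which makes {c, a} a piece *)
pose e3 := upd e2 a (h2 s0 *: e2 a).
have e23 : reach (rel_on r B) e2 e3 by apply: reach_scale1.
have notin_a (s : {set I}) : s \in C -> a \notin s.
  move=> sC; have [/subsetP sub _] := hC _ sC.
  by apply: contraL aD => /sub; rewrite inE => /andP[].
have cs0 : c \in s0 by rewrite Es0 inE.
exists D', e3, ([set c; a] |: C :\ s0); split=> //.
  exact: reach_trans ee2 e23.
split.
- have dj (s : {set I}) : s \in C -> s != s0 -> [disjoint [set c; a] & s].
    move=> sC ne; rewrite disjoints_subset subUset !sub1set !inE notin_a // andbT.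
    by rewrite (disjointFl (trivIsetP tC _ _ sC s0C ne) cs0).
  apply/trivIsetP => s t; rewrite !inE => /orP[/eqP->|/andP[ss0 sC]] /orP[/eqP->|/andP[ts0 tC']];
    rewrite ?eqxx // => ne.
  + exact: dj.
  + by rewrite disjoint_sym; apply: dj.
  + exact: (trivIsetP tC).
- move=> s; rewrite !inE => /orP[/eqP->|/andP[_ sC]]; last first.
    by have [h1 h3] := hC _ sC; split=> //; apply: sub_D.
  split; last by right; exists c, a.
  rewrite subUset !sub1set aBD andbT; apply: (subsetP (sub_D s0 _)) => //.
  by have [] := hC _ s0C.
have -> : span_on e3 D' = span_on e2 D'.
  by apply: eq_span_on => i iD; rewrite /e3 /upd; case: eqVneq => // E; rewrite -E iD in aD'.
rewrite eqD' in EY2 *; rewrite EY2; congr (_ + _)%VS.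
rewrite -{1}(setD1K s0C) !span_on_setU1; congr (_ + _)%VS; last first.
  apply: eq_span_on => s; rewrite !inE => /andP[ss0 sC].
  by rewrite /shifted h0 // scale0r addr0 /e3 sum_on_upd (negPf (notin_a _ sC)).
have ca : c != a by apply: contraNneq nac => ->.
congr (<[_]>)%VS.
rewrite /shifted {1}Es0 /sum_on big_set1 big_setU1 ?inE //= big_set1 /e3 /upd eqxx.
by rewrite (negPf ca).
Qed.

Lemma pair_adapt (e : I -> V) (Y : {vspace V}) :
  (Y <= span_on e B)%VS ->
  exists (e' : I -> V) (C : {set {set I}}),
  [/\ reach (rel_on r B) e e', trivIset C,
      {in C, forall s : {set I}, s \subset B /\ piece r s} &
      Y = span_on (sum_on e') C].
Proof.
move=> YB; have [D [e' [C [_ cD _ ee' [tC hC EY]]]]] := pair_adapt_partial YB (leqnn _).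
have D0 : D = set0 by apply/eqP; rewrite -cards_eq0 -(eqn_add2r #|B|) cD.
exists e', C; split=> //; first by move=> s /hC; rewrite D0 setD0.
by move: EY; rewrite D0 {1 3}/span_on !big_set0 !addv0.
Qed.

End Adapt.
End Families.

(** * Bases adapted to flags and subspaces *)

Section Chains.
Variables (F : fieldType) (V : vectType F).
Implicit Types I : finType.

Lemma chain_adapt I (r : rel I) (B : {set I}) (e : I -> V) (Y : {vspace V}) :
  reflexive r -> transitive r -> total r -> (Y <= span_on e B)%VS ->
  exists (e' : I -> V) (A : {set I}),
  [/\ reach (rel_on r B) e e', A \subset B & Y = span_on e' A].
Proof.
move=> rr rt tot YB.
have wB : width_le2 r B by move=> a b c _ _ _; have /orP[-> //|->] := tot a b; rewrite orbT.
have [e' [C [ee' _ hC ->]]] := pair_adapt rr rt wB YB.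
have sing s : s \in C -> exists a, s = [set a].
  move=> /hC[_ [//|[a [b [_ nab nba]]]]].
  by have := tot a b; rewrite (negPf nab) (negPf nba).
exists e', (cover C); split=> //.
  by apply/subsetP => i /bigcupP[s /hC[/subsetP sub _] /sub].
apply/eqP; rewrite eqEsubv; apply/andP; split; apply/span_on_subP.
  move=> s sC; have [a Es] := sing s sC.
  rewrite Es /sum_on big_set1; apply: mem_span_on.
  by apply/bigcupP; exists s => //; rewrite Es inE.
move=> i /bigcupP[s sC is_]; have [a Es] := sing s sC.
have -> : e' i = sum_on e' s by move: is_; rewrite Es inE => /eqP->; rewrite /sum_on big_set1.
exact: mem_span_on.
Qed.

(** Flags are treated from the largest member down, each one inside the part of
    the family that spans the previous one; the label of an index is the position
    of the first member containing the vector. *)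
Lemma flag_adapt I (r : rel I) (B : {set I}) (e : I -> V) (Y : nat -> {vspace V}) m :
  reflexive r -> transitive r -> total r ->
  (forall d, (d < m)%N -> (Y d <= Y d.+1)%VS) -> (Y m <= span_on e B)%VS ->
  exists (e' : I -> V) (lab : I -> nat),
  [/\ reach (rel_on r B) e e', forall a, (lab a <= m.+1)%N &
      forall d, (d <= m)%N -> Y d = span_on e' [set a in B | (lab a <= d)%N]].
Proof.
move=> rr rt tot; elim: m B e => [|m ih] B e mono YB;
  have [e1 [A [ee1 AB EY]]] := chain_adapt rr rt tot YB.
  exists e1, (fun a => if a \in A then 0 else 1)%N; split=> // [a|d].
    by case: ifP.
  rewrite leqn0 => /eqP->; rewrite EY; congr span_on; apply/setP => a; rewrite !inE.
  by case: ifP => [/(subsetP AB)->|]; rewrite ?andbF.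
have [||e2 [lab [e12 lm EY2]]] := ih A e1.
- by move=> d dm; apply: mono; apply: ltnW.
- by rewrite -EY; apply: mono.
exists e2, (fun a => if a \in A then lab a else m.+2); split=> [|a|d].
- apply: (reach_trans ee1); apply: reach_sub e12 => a c /and3P[rac aA cA].
  by rewrite /rel_on rac !(subsetP AB).
- by case: ifP => // _; apply: leq_trans (lm a) _.
rewrite leq_eqVlt => /orP[/eqP->|dm].
  have -> : Y m.+1 = span_on e2 A.
    by rewrite EY; apply: reach_span e12 => a c /and3P[].
  congr span_on; apply/setP => a; rewrite !inE.
  case: ifP => [aA|]; last by rewrite ltnn andbF.
  by rewrite (subsetP AB) // lm.
rewrite EY2 //; congr span_on; apply/setP => a; rewrite !inE.
case: ifP => [/(subsetP AB)-> //|_].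
by rewrite [(_ < _)%N](_ : _ = false) ?andbF //; apply/negbTE; rewrite -ltnNge ltnS (leq_trans _ (leqnSn _)).
Qed.

Lemma reach_spanT I (r : rel I) e e' : reach r e e' ->
  span_on e setT = span_on e' (setT : {set I}) :> {vspace V}.
Proof. by apply: reach_span => a c _; rewrite !inE. Qed.

(** Moves for this relation preserve both the flag of label at most d, for
    every d, and the span over A. *)
Definition two_flag_rel I (lab : I -> nat) (A : {set I}) : rel I :=
  fun a b => (lab a <= lab b)%N && ((b \in A) ==> (a \in A)).

Lemma two_flag_rel_refl I lab (A : {set I}) : reflexive (two_flag_rel lab A).
Proof. by move=> a; rewrite /two_flag_rel leqnn implybb. Qed.

Lemma two_flag_rel_trans I lab (A : {set I}) : transitive (two_flag_rel lab A).
Proof.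
move=> b a c /andP[ab /implyP AB] /andP[bc /implyP BC].
by rewrite /two_flag_rel (leq_trans ab bc); apply/implyP => /BC /AB.
Qed.

(** Among three indices, two agree on membership in A, and these are comparable
    through their labels. *)
Lemma two_flag_rel_width I lab (A B : {set I}) : width_le2 (two_flag_rel lab A) B.
Proof.
move=> a b c _ _ _; rewrite /two_flag_rel.
by case: (leqP (lab a) (lab b)) => h1; case: (leqP (lab a) (lab c)) => h2;
  case: (leqP (lab b) (lab c)) => h3; rewrite ?(ltnW h1) ?(ltnW h2) ?(ltnW h3);
  case: (a \in A); case: (b \in A); case: (c \in A) => //=; rewrite ?orbT.
Qed.

Lemma reach_two_flag I lab (A : {set I}) (e e' : I -> V) :
  reach (two_flag_rel lab A) e e' ->
  [/\ span_on e setT = span_on e' setT, span_on e A = span_on e' A &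
   forall d, span_on e [set a | (lab a <= d)%N] = span_on e' [set a | (lab a <= d)%N]].
Proof.
move=> ee'; split; first exact: reach_spanT ee'.
  by apply: reach_span ee' => a c /andP[_ /implyP].
by move=> d; apply: reach_span ee' => a c /andP[ac _]; rewrite !inE; apply: leq_trans.
Qed.

Lemma rel_on_sub I (r : rel I) B : subrel (rel_on r B) r.
Proof. by move=> a b /and3P[]. Qed.

Lemma basis_family (M : {vspace V}) :
  span_on (fun i : 'I_(\dim M) => (vbasis M)`_i) setT = M.
Proof.
rewrite -[RHS](span_basis (vbasisP M)) span_def /span_on.
rewrite (big_nth 0) big_mkord size_tuple; apply: eq_bigl => i.
by rewrite inE.
Qed.

Lemma adapt_flag_subspace (M : {vspace V}) (L : nat -> {vspace V}) m (U : {vspace V}) :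
  (forall d, (d < m)%N -> (L d <= L d.+1)%VS) -> (L m <= M)%VS -> (U <= M)%VS ->
  exists (e : 'I_(\dim M) -> V) (lab : 'I_(\dim M) -> nat) (A : {set 'I_(\dim M)}),
  [/\ span_on e setT = M, forall a, (lab a <= m.+1)%N,
      forall d, (d <= m)%N -> L d = span_on e [set a | (lab a <= d)%N] &
      U = span_on e A].
Proof.
move=> mono LM UM.
have Lm : (L m <= span_on (fun i : 'I_(\dim M) => (vbasis M)`_i) setT)%VS.
  by rewrite basis_family.
have [//|//|//|e1 [lab [r1 lm EL]]] := flag_adapt (r := fun _ _ => true) _ _ _ mono Lm.
have [||||e2 [A [r2 _ EU]]] := @chain_adapt 'I_(\dim M) (fun a b => lab a <= lab b)%N setT e1 U.
- by move=> a; apply: leqnn.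
- by move=> a b c; apply: leq_trans.
- by move=> a b; apply: leq_total.
- by rewrite -(reach_spanT r1) basis_family.
exists e2, lab, A; split=> //; first by rewrite -(reach_spanT r2) -(reach_spanT r1) basis_family.
move=> d dm; rewrite EL // -(@reach_span _ _ _ _ _ _ _ _ r2).
  by congr span_on; apply/setP => a; rewrite !inE.
by move=> a c /and3P[ac _ _]; rewrite !inE; apply: leq_trans.
Qed.

Lemma adapt_flag_two_subspaces (M : {vspace V}) (L : nat -> {vspace V}) m (U Y : {vspace V}) :
  (forall d, (d < m)%N -> (L d <= L d.+1)%VS) -> (L m <= M)%VS -> (U <= M)%VS ->
  (Y <= M)%VS ->
  exists (e : 'I_(\dim M) -> V) (lab : 'I_(\dim M) -> nat) (A : {set 'I_(\dim M)})
    (C : {set {set 'I_(\dim M)}}),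
  [/\ span_on e setT = M, forall a, (lab a <= m.+1)%N,
      forall d, (d <= m)%N -> L d = span_on e [set a | (lab a <= d)%N],
      U = span_on e A & trivIset C /\ Y = span_on (sum_on e) C].
Proof.
move=> mono LM UM YM.
have [e [lab [A [EM lm EL EU]]]] := adapt_flag_subspace mono LM UM.
have Y1 : (Y <= span_on e setT)%VS by rewrite EM.
have [e1 [C [r1 tC _ EY]]] := pair_adapt (@two_flag_rel_refl _ lab A)
  (@two_flag_rel_trans _ lab A) (@two_flag_rel_width _ lab A setT) Y1.
have [E1 E2 E3] := reach_two_flag (reach_sub (@rel_on_sub _ _ _) r1).
exists e1, lab, A, C; split=> //; rewrite -?E1 -?E2 //.
by move=> d dm; rewrite -E3 EL.
Qed.

(** The order J(2 x 3) of Young diagrams with at most two rows of length at most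
    three, given by their row lengths. *)
Lemma staircase_width x1 y1 x2 y2 x3 y3 :
  (x1 <= y1 <= 3)%N -> (x2 <= y2 <= 3)%N -> (x3 <= y3 <= 3)%N ->
  [|| (y1 <= y2) && (x1 <= x2), (y2 <= y1) && (x2 <= x1),
      (y1 <= y3) && (x1 <= x3), (y3 <= y1) && (x3 <= x1),
      (y2 <= y3) && (x2 <= x3) | (y3 <= y2) && (x3 <= x2)]%N.
Proof. lia. Qed.

(** A down-set of the relation is determined by the largest labels that occur,
    in it and in its part outside A, that is by a diagram as in
    [staircase_width]. *)
Lemma dominated_width I (lab : I -> nat) (A : {set I}) (C : {set {set I}}) :
  (forall a, (lab a <= 2)%N) -> width_le2 (dominated (two_flag_rel lab A)) C.
Proof.
move=> lab2.
pose y (s : {set I}) := \max_(a in s) (lab a).+1.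
pose x (s : {set I}) := \max_(a in s | a \notin A) (lab a).+1.
have xy s : (x s <= y s <= 3)%N.
  apply/andP; split.
    by apply/bigmax_leqP => a /andP[as_ _]; exact: (@leq_bigmax_cond _ (fun i => i \in s) (fun i => (lab i).+1) a).
  by apply/bigmax_leqP => a _; rewrite ltnS.
have dom t s : ((y t <= y s) && (x t <= x s))%N -> dominated (two_flag_rel lab A) t s.
  case/andP=> yts xts; apply/forall_inP => b bt.
  apply: contraT => /exists_inPn N.
  have [bA|bA] := boolP (b \in A).
    have : (y t <= lab b)%N.
      apply: leq_trans yts _; apply/bigmax_leqP => a as_; rewrite ltnNge; apply/negP => ba.
      by have := N a as_; rewrite /two_flag_rel ba bA implybT.
    by rewrite leqNgt (@leq_bigmax_cond _ (fun i => i \in t) (fun i => (lab i).+1) b).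
  have : (x t <= lab b)%N.
    apply: leq_trans xts _; apply/bigmax_leqP => a /andP[as_ aA]; rewrite ltnNge; apply/negP => ba.
    by have := N a as_; rewrite /two_flag_rel ba (negPf aA).
  by rewrite leqNgt (@leq_bigmax_cond _ (fun i => (i \in t) && (i \notin A)) (fun i => (lab i).+1) b) ?bt.
move=> s t u _ _ _; apply: contraT; rewrite !negb_or => /and5P[n1 n2 n3 n4 /andP[n5 n6]].
have := staircase_width (xy s) (xy t) (xy u).
by rewrite (negPf (contra (dom _ _) n1)) (negPf (contra (dom _ _) n2))
  (negPf (contra (dom _ _) n3)) (negPf (contra (dom _ _) n4))
  (negPf (contra (dom _ _) n5)) (negPf (contra (dom _ _) n6)).
Qed.

Lemma dominated_refl I (r : rel I) : reflexive r -> reflexive (dominated r).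
Proof. by move=> rr s; apply/forall_inP => a as_; apply/exists_inP; exists a. Qed.

Lemma dominated_trans I (r : rel I) : transitive r -> transitive (dominated r).
Proof.
move=> rt t s u /forall_inP st /forall_inP tu; apply/forall_inP => a /st /exists_inP[b bt ab].
by have /exists_inP[c cu bc] := tu b bt; apply/exists_inP; exists c => //; apply: rt ab bc.
Qed.

(** After adapting a basis to L1, L2, U and R2, the subspace R1 is treated in R2,
    whose basis consists of the pieces found for R2. *)
Lemma adapt_two_flags_subspace (M L1 L2 R1 R2 U : {vspace V}) :
  (L1 <= L2)%VS -> (L2 <= M)%VS -> (R1 <= R2)%VS -> (R2 <= M)%VS -> (U <= M)%VS ->
  exists (e : 'I_(\dim M) -> V) (A1 A2 AU : {set 'I_(\dim M)})
    (C : {set {set 'I_(\dim M)}}) (C' : {set {set {set 'I_(\dim M)}}}),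
  [/\ span_on e setT = M, L1 = span_on e A1 /\ L2 = span_on e A2,
      U = span_on e AU, R2 = span_on (sum_on e) C &
      R1 = span_on (sum_on (sum_on e)) C'].
Proof.
move=> L12 L2M R12 R2M UM.
pose L d := if d is 0 then L1 else L2.
have mono d : (d < 1)%N -> (L d <= L d.+1)%VS by case: d.
have [e [lab [A [C [EM lm EL EU [tC ER2]]]]]] := adapt_flag_two_subspaces mono L2M UM R2M.
have R1C : (R1 <= span_on (sum_on e) C)%VS by rewrite -ER2.
have [y [C' [ry _ hC' ER1]]] := pair_adapt (dominated_refl (@two_flag_rel_refl _ lab A))
  (dominated_trans (@two_flag_rel_trans _ lab A)) (@dominated_width _ lab A C lm) R1C.
have [e1 re1 hy] := reach_lift tC (fun s _ => erefl) ry.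
have [E1 E2 E3] := reach_two_flag re1.
exists e1, [set a | (lab a <= 0)%N], [set a | (lab a <= 1)%N], A, C, C'; split.
- by rewrite -E1.
- by rewrite -!E3 -!EL.
- by rewrite -E2.
- rewrite ER2 (@reach_span _ _ _ _ _ _ _ _ ry).
    by apply: eq_span_on.
  by move=> a c /and3P[].
- rewrite ER1; apply: eq_span_on => t /hC'[/subsetP tC' _].
  by apply: eq_bigr => s /tC'; apply: hy.
Qed.

Lemma lin_of_basis N (e e' : 'I_N -> V) : \dim (span_on e setT) = N ->
  exists f : 'End(V), forall i, f (e i) = e' i.
Proof.
move=> dN; pose X := [tuple e i | i < N].
have XE (i : 'I_N) : X`_i = e i by rewrite -tnth_nth tnth_mktuple.
have fX : free X.
  rewrite /free size_tuple; apply/eqP; rewrite -[RHS]dN; congr (\dim _).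
  rewrite span_def /span_on (big_nth 0) big_mkord size_tuple.
  by apply: eq_big => [i|i _]; rewrite ?inE ?XE.
have [f fP] := linear_of_free X [tuple e' i | i < N].
exists (linfun f) => i; rewrite lfunE /=.
have /= E := fP fX _; rewrite -XE -(nth_map 0 0) ?size_tuple //.
by rewrite (E _) ?size_tuple // (nth_map i) ?size_enum_ord // nth_ord_enum.
Qed.

End Chains.

(** * Finite invariants of configurations *)

Section Codes.
Variables (F : fieldType) (V : vectType F).

Lemma adapt_two_flags (M : {vspace V}) (L R : nat -> {vspace V}) m :
  (forall d, (d < m)%N -> (L d <= L d.+1)%VS) -> (L m <= M)%VS ->
  (forall d, (d < m)%N -> (R d <= R d.+1)%VS) -> (R m <= M)%VS ->
  exists (e : 'I_(\dim M) -> V) (lab lab' : 'I_(\dim M) -> nat),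
  [/\ span_on e setT = M,
      forall d, (d <= m)%N -> L d = span_on e [set a | (lab a <= d)%N] &
      forall d, (d <= m)%N -> R d = span_on e [set a | (lab' a <= d)%N]].
Proof.
move=> Lmono LM Rmono RM.
have [e [lab [A [EM lm EL EU]]]] := adapt_flag_subspace Lmono LM (subvv M).
have Rm : (R m <= span_on e setT)%VS by rewrite EM.
have [|||e1 [lab' [r1 _ ER]]] := flag_adapt (r := fun a b => (lab a <= lab b)%N) _ _ _ Rmono Rm.
- by move=> a; apply: leqnn.
- by move=> a b c; apply: leq_trans.
- by move=> a b; apply: leq_total.
exists e1, lab, lab'; split; first by rewrite -(reach_spanT r1).
- move=> d dm; rewrite EL //; apply: reach_span r1 => a c /and3P[ac _ _].
  by rewrite !inE; apply: leq_trans.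
- by move=> d dm; rewrite ER //; congr span_on; apply/setP => a; rewrite !inE.
Qed.

Lemma lfun_sum_on (I : finType) (e e' : I -> V) (f : 'End(V)) (s : {set I}) :
  (forall i, f (e i) = e' i) -> f (sum_on e s) = sum_on e' s.
Proof. by move=> h; rewrite linear_sum; apply: eq_bigr => i _; apply: h. Qed.


Lemma limg_span_sum_on (I : finType) (e e' : I -> V) (f : 'End(V)) (C : {set {set I}}) :
  (forall i, f (e i) = e' i) ->
  (f @: span_on (sum_on e) C = span_on (sum_on e') C)%VS.
Proof. by move=> h; apply: limg_span_on => s _; apply: lfun_sum_on. Qed.

(** Each of the next three predicates says that the index sets in c describe the
    given subspaces in terms of some basis. The index sets range over a finite
    type, and two configurations with the same index sets are isomorphic. *)
Definition two_flags_form N m (M : {vspace V}) (L R : nat -> {vspace V})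
    (c : {ffun 'I_m.+1 -> {set 'I_N}} * {ffun 'I_m.+1 -> {set 'I_N}}) : Prop :=
  exists e : 'I_N -> V, [/\ span_on e setT = M,
    forall d : 'I_m.+1, L d = span_on e (c.1 d) &
    forall d : 'I_m.+1, R d = span_on e (c.2 d)].

Lemma two_flags_form_exists N m (M : {vspace V}) (L R : nat -> {vspace V}) :
  \dim M = N ->
  (forall d, (d < m)%N -> (L d <= L d.+1)%VS) -> (L m <= M)%VS ->
  (forall d, (d < m)%N -> (R d <= R d.+1)%VS) -> (R m <= M)%VS ->
  exists c, @two_flags_form N m M L R c.
Proof.
move=> <- Lmono LM Rmono RM.
have [e [lab [lab' [EM EL ER]]]] := adapt_two_flags Lmono LM Rmono RM.
exists ([ffun d : 'I_m.+1 => [set a | (lab a <= d)%N]],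
        [ffun d : 'I_m.+1 => [set a | (lab' a <= d)%N]]), e.
by split=> // d; rewrite ffunE ?EL ?ER // -ltnS.
Qed.

Lemma two_flags_form_iso N m (M M' : {vspace V}) (L R L' R' : nat -> {vspace V}) c :
  \dim M = N -> @two_flags_form N m M L R c -> @two_flags_form N m M' L' R' c ->
  exists f : 'End(V), (f @: M = M')%VS /\
    forall d, (d <= m)%N -> (f @: L d = L' d)%VS /\ (f @: R d = R' d)%VS.
Proof.
move=> dM [e [EM EL ER]] [e' [EM' EL' ER']].
have [|f fE] := lin_of_basis e' (_ : \dim (span_on e setT) = N); first by rewrite EM.
exists f; split; first by rewrite -EM -EM'; apply: limg_span_on.
move=> d; rewrite -ltnS => dm.
by rewrite (EL (Ordinal dm)) (ER (Ordinal dm)) (EL' (Ordinal dm)) (ER' (Ordinal dm));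
  split; apply: limg_span_on.
Qed.

Definition flag_subspaces_form N m (M : {vspace V}) (L : nat -> {vspace V}) (U Y : {vspace V})
    (c : {ffun 'I_m.+1 -> {set 'I_N}} * {set 'I_N} * {set {set 'I_N}}) : Prop :=
  exists e : 'I_N -> V, [/\ span_on e setT = M,
    forall d : 'I_m.+1, L d = span_on e (c.1.1 d),
    U = span_on e c.1.2 & Y = span_on (sum_on e) c.2].

Lemma flag_subspaces_form_exists N m (M : {vspace V}) (L : nat -> {vspace V}) (U Y : {vspace V}) :
  \dim M = N ->
  (forall d, (d < m)%N -> (L d <= L d.+1)%VS) -> (L m <= M)%VS ->
  (U <= M)%VS -> (Y <= M)%VS ->
  exists c, @flag_subspaces_form N m M L U Y c.
Proof.
move=> <- mono LM UM YM.
have [e [lab [A [C [EM _ EL EU [_ EY]]]]]] := adapt_flag_two_subspaces mono LM UM YM.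
exists ([ffun d : 'I_m.+1 => [set a | (lab a <= d)%N]], A, C), e.
by split=> // d; rewrite ffunE EL // -ltnS.
Qed.

Lemma flag_subspaces_form_iso N m (M M' : {vspace V}) (L L' : nat -> {vspace V})
    (U Y U' Y' : {vspace V}) c :
  \dim M = N -> @flag_subspaces_form N m M L U Y c ->
  @flag_subspaces_form N m M' L' U' Y' c ->
  exists f : 'End(V), [/\ (f @: M = M')%VS,
    forall d, (d <= m)%N -> (f @: L d = L' d)%VS, (f @: U = U')%VS & (f @: Y = Y')%VS].
Proof.
move=> dM [e [EM EL EU EY]] [e' [EM' EL' EU' EY']].
have [|f fE] := lin_of_basis e' (_ : \dim (span_on e setT) = N); first by rewrite EM.
exists f; split.
- by rewrite -EM -EM'; apply: limg_span_on.
- move=> d; rewrite -ltnS => dm.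
  by rewrite (EL (Ordinal dm)) (EL' (Ordinal dm)); apply: limg_span_on.
- by rewrite EU EU'; apply: limg_span_on.
- by rewrite EY EY'; apply: limg_span_sum_on.
Qed.

Definition two_short_flags_form N (M L1 L2 R1 R2 U : {vspace V})
    (c : {set 'I_N} * {set 'I_N} * {set 'I_N} * {set {set 'I_N}} *
         {set {set {set 'I_N}}}) : Prop :=
  exists e : 'I_N -> V, [/\ span_on e setT = M,
    L1 = span_on e c.1.1.1.1 /\ L2 = span_on e c.1.1.1.2,
    U = span_on e c.1.1.2, R2 = span_on (sum_on e) c.1.2 &
    R1 = span_on (sum_on (sum_on e)) c.2].

Lemma two_short_flags_form_exists N (M L1 L2 R1 R2 U : {vspace V}) :
  \dim M = N ->
  (L1 <= L2)%VS -> (L2 <= M)%VS -> (R1 <= R2)%VS -> (R2 <= M)%VS -> (U <= M)%VS ->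
  exists c, @two_short_flags_form N M L1 L2 R1 R2 U c.
Proof.
move=> <- L12 L2M R12 R2M UM.
have [e [A1 [A2 [AU [C [C' h]]]]]] := adapt_two_flags_subspace L12 L2M R12 R2M UM.
by exists (A1, A2, AU, C, C'), e.
Qed.

Lemma two_short_flags_form_iso N (M L1 L2 R1 R2 U M' L1' L2' R1' R2' U' : {vspace V}) c :
  \dim M = N -> @two_short_flags_form N M L1 L2 R1 R2 U c ->
  @two_short_flags_form N M' L1' L2' R1' R2' U' c ->
  exists f : 'End(V), [/\ (f @: M = M')%VS, (f @: L1 = L1')%VS /\ (f @: L2 = L2')%VS,
    (f @: R1 = R1')%VS /\ (f @: R2 = R2')%VS & (f @: U = U')%VS].
Proof.
move=> dM [e [EM [EL1 EL2] EU ER2 ER1]] [e' [EM' [EL1' EL2'] EU' ER2' ER1']].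
have [|f fE] := lin_of_basis e' (_ : \dim (span_on e setT) = N); first by rewrite EM.
exists f; split.
- by rewrite -EM -EM'; apply: limg_span_on.
- by rewrite EL1 EL1' EL2 EL2'; split; apply: limg_span_on.
- rewrite ER1 ER1' ER2 ER2'; split; last exact: limg_span_sum_on.
  by apply: limg_span_sum_on => s; apply: lfun_sum_on.
- by rewrite EU EU'; apply: limg_span_on.
Qed.
End Codes.

(** * Extension of linear maps respecting a flag *)

Section Extension.
Variables (F : fieldType) (V : vectType F).

Lemma glue_lfun (f g : 'End(V)) (U W : {vspace V}) : (U :&: W = 0)%VS ->
  exists h : 'End(V), {in U, h =1 f} /\ {in W, h =1 g}.
Proof.
move=> UW; exists ((f \o daddv_pi U W) + (g \o daddv_pi W U))%VF.
have WU : (W :&: U = 0)%VS by rewrite capvC.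
split=> u uU; rewrite add_lfunE !comp_lfunE.
  rewrite daddv_pi_id //.
  have := daddv_pi_add UW (subvP (addvSl U W) u uU).
  rewrite daddv_pi_id // => /eqP; rewrite -subr_eq0 addrC addKr => /eqP->.
  by rewrite linear0 addr0.
rewrite [daddv_pi W U u]daddv_pi_id //.
have := daddv_pi_add UW (subvP (addvSr U W) u uU).
rewrite [daddv_pi W U u]daddv_pi_id // => /eqP; rewrite -subr_eq0 addrK => /eqP->.
by rewrite linear0 add0r.
Qed.

Lemma line_map (x x' : V) : x != 0 -> exists f : 'End(V), f x = x'.
Proof.
move=> x0; have [|f fP] := @lin_of_basis _ _ 1 (fun _ => x) (fun _ => x').
  by rewrite /span_on (eq_bigl predT) ?big_ord1 ?dim_vline ?x0 // => i; rewrite inE.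
by exists f; apply: (fP ord0).
Qed.

Lemma eq_limg (f g : 'End(V)) (U : {vspace V}) : {in U, f =1 g} -> (f @: U = g @: U)%VS.
Proof. by move=> h; apply: eq_in_limg. Qed.

Lemma capv_line_notin (x : V) (B : {vspace V}) : x \notin B -> (B :&: <[x]> = 0)%VS.
Proof.
move=> xB; apply/eqP; rewrite -subv0; apply/subvP => y /memv_capP[yB /vlineP[k Ey]].
have [k0|k0] := eqVneq k 0; first by rewrite Ey k0 scale0r mem0v.
by move: yB; rewrite Ey => /(memvZ k^-1); rewrite scalerA mulVf // scale1r (negPf xB).
Qed.

(** B is enlarged by one vector at a time. If d is minimal with Fl d not
    contained in B, then Fl d is not contained in the image of B either, for
    dimension reasons; so a vector of Fl d outside B can be sent to a vector of
    Fl d outside the image. By minimality of d, all traces still match. *)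
Lemma extend_flag_iso (Fl : nat -> {vspace V}) m (f : 'End(V)) (B : {vspace V}) :
  (forall d e, (d <= e <= m)%N -> (Fl d <= Fl e)%VS) ->
  (B <= Fl m)%VS -> (f @: B <= Fl m)%VS -> \dim (f @: B) = \dim B ->
  (forall d, (d <= m)%N -> (f @: (B :&: Fl d) = (f @: B) :&: Fl d)%VS) ->
  exists g : 'End(V), {in B, g =1 f} /\ forall d, (d <= m)%N -> (g @: Fl d = Fl d)%VS.
Proof.
move=> mono; have [k] := ubnP (\dim (Fl m) - \dim B).
elim: k f B => // k ih f B; rewrite ltnS => hk Bm fBm dB hf.
have kerB : (B :&: lker f = 0)%VS.
  apply/eqP; rewrite -dimv_eq0; move: (limg_ker_dim f B); rewrite dB => /eqP.
  by rewrite -{2}[\dim B]add0n eqn_add2r.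
have dimf U : (U <= B)%VS -> \dim (f @: U) = \dim U.
  move=> UB; apply: limg_dim_eq; apply/eqP; rewrite -subv0 -kerB.
  by apply: capvS.
case: (boolP (Fl m <= B)%VS) => [mB|mB].
  have EB : B = Fl m by apply/eqP; rewrite eqEsubv Bm.
  have EfB : (f @: B = Fl m)%VS by apply/eqP; rewrite eqEdim fBm dB EB leqnn.
  exists f; split=> // d dm; have Fdm : (Fl d <= Fl m)%VS by apply: mono; rewrite dm leqnn.
  by have := hf d dm; rewrite EfB EB (capv_idPr Fdm).
have ex_d : exists d, (d <= m)%N && ~~ (Fl d <= B)%VS by exists m; rewrite leqnn.
case: (ex_minnP ex_d) => d /andP[dm /subvPn[x xd xB]] dmin.
have Flt e : (e < d)%N -> (Fl e <= B)%VS.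
  move=> ed; apply: contraT => neB; have := dmin e.
  by rewrite neB andbT (leq_trans (ltnW ed) dm) leqNgt ed => /(_ isT).
have /subvPn[x' x'd x'B] : ~~ (Fl d <= f @: B)%VS.
  apply/negP => dB'.
  have : (Fl d <= B)%VS.
    have : \dim (B :&: Fl d) = \dim (Fl d).
      rewrite -(dimf _ (capvSl _ _)) hf //; congr (\dim _); exact/capv_idPr.
    move=> E; have /eqP <- : (B :&: Fl d == Fl d)%VS by rewrite eqEdim capvSr E leqnn.
    exact: capvSl.
  by move/subvP/(_ x xd); rewrite (negPf xB).
have x0 : x != 0 by apply: contraNneq xB => ->; apply: mem0v.
have [l lx] := line_map x' x0.
have [f1 [f1B f1x]] := glue_lfun f l (capv_line_notin xB).
have f1x' : f1 x = x' by rewrite f1x ?memv_line.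
have f1B' : (f1 @: B = f @: B)%VS by apply: eq_limg.
have Ef1 : (f1 @: (B + <[x]>) = f @: B + <[x']>)%VS.
  by rewrite limgD f1B' limg_line f1x'.
have dim1 (W : {vspace V}) y : y \notin W -> \dim (W + <[y]>) = (\dim W).+1.
  move=> yW; rewrite dimv_disjoint_sum ?capv_line_notin // dim_vline addnC.
  by rewrite (_ : y != 0) //; apply: contraNneq yW => ->; apply: mem0v.
have Fe_m e : (e <= m)%N -> (Fl e <= Fl m)%VS by move=> em; apply: mono; rewrite em leqnn.
have xm : x \in Fl m by apply: (subvP (Fe_m d dm)).
have x'm : x' \in Fl m by apply: (subvP (Fe_m d dm)).
have B1m : (B + <[x]> <= Fl m)%VS by rewrite subv_add Bm -memvE.
have [||||g [gB gF]] := ih f1 (B + <[x]>)%VS _ B1m.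
- rewrite dim1 //; move: hk; have := dimvS B1m; rewrite dim1 //; lia.
- by rewrite Ef1 subv_add fBm -memvE.
- by rewrite Ef1 !dim1 // dB.
- move=> e em; rewrite Ef1; case: (ltnP e d) => ed.
    have FeB := Flt e ed.
    have fFe : (f @: Fl e = Fl e)%VS.
      have := hf e em; rewrite (capv_idPr FeB) => E.
      by apply/eqP; rewrite eqEdim dimf // leqnn andbT E capvSr.
    rewrite (capv_idPr (subv_trans FeB (addvSl _ _))).
    have -> : (f1 @: Fl e = Fl e)%VS.
      by rewrite -{2}fFe; apply: eq_limg => y yF; apply: f1B; apply: (subvP FeB).
    apply/esym/capv_idPr; apply: subv_trans (addvSl _ _).
    by rewrite -{1}fFe; apply: limgS.
  have Fde : (Fl d <= Fl e)%VS by apply: mono; rewrite ed.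
  have xe : (<[x]> <= Fl e)%VS by rewrite -memvE (subvP Fde).
  have x'e : (<[x']> <= Fl e)%VS by rewrite -memvE (subvP Fde).
  rewrite !(capvC _ (Fl e)) -!vspace_modr // limgD limg_line f1x'; congr (_ + _)%VS.
  rewrite !(capvC (Fl e)).
  by rewrite -hf //; apply: eq_limg => y /memv_capP[yB _]; apply: f1B.
exists g; split=> // y yB; rewrite gB ?f1B //; exact: (subvP (addvSl _ _)).
Qed.

(** The map induced by f between the projections of M and of its image to X is
    well defined because f matches the intersections with Y, the case d = 0 of
    the last hypothesis; it is then extended to X. *)
Lemma extend_to_summand (X Y : {vspace V}) (Fl : nat -> {vspace V}) m (f : 'End(V)) (M : {vspace V}) :
  (X :&: Y = 0)%VS -> (X + Y = fullv)%VS ->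
  (forall d e, (d <= e <= m)%N -> (Fl d <= Fl e)%VS) ->
  Fl 0%N = 0%VS -> Fl m = X -> \dim (f @: M) = \dim M ->
  (forall d, (d <= m)%N -> (f @: (M :&: (Fl d + Y)) = (f @: M) :&: (Fl d + Y))%VS) ->
  exists g : 'End(V), (forall d, (d <= m)%N -> (g @: Fl d = Fl d)%VS) /\
    {in M, forall x, g (daddv_pi X Y x) = daddv_pi X Y (f x)}.
Proof.
move=> XY XYT mono F0 Fm dM hf.
set p := daddv_pi X Y.
have pX x : p x \in X by apply: memv_pi.
have pid x : x \in X -> p x = x by apply: daddv_pi_id.
have pY y : y \in Y -> p y = 0.
  move=> yY; have := daddv_pi_add XY (subvP (addvSr X Y) y yY).
  rewrite [daddv_pi Y X y]daddv_pi_id ?[(Y :&: X)%VS]capvC // => /eqP.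
  by rewrite -subr_eq0 addrK => /eqP.
have pq x : x - p x \in Y.
  have -> : x - p x = daddv_pi Y X x.
    by rewrite -{1}(daddv_pi_add XY (_ : x \in _)) ?XYT ?memvf // addrAC subrr add0r.
  exact: memv_pi.
have memFY d x : (d <= m)%N -> (x \in (Fl d + Y)%VS) = (p x \in Fl d).
  move=> dm; have FX : (Fl d <= X)%VS by rewrite -Fm mono // dm leqnn.
  apply/idP/idP => [/memv_addP[u uF [y yY ->]]|h].
    by rewrite linearD /= (pY y) // addr0 pid // (subvP FX).
  by rewrite -[x](subrK (p x)) addrC memv_add.
have pker x : p x = 0 -> x \in Y by move=> px; have := pq x; rewrite px subr0.
pose B := (p @: M)%VS.
(* s is a linear section over B of the projection from M. *)
pose q := (p \o projv M)%VF.
pose s := (projv M \o q^-1)%VF.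
have sM b : s b \in M by rewrite comp_lfunE memv_proj.
have sK b : b \in B -> p (s b) = b.
  move=> bB; rewrite comp_lfunE -[p _](comp_lfunE p (projv M)) limg_lfunVK //.
  case/memv_imgP: bB => u uM ->; rewrite -(projv_id uM) -[p _](comp_lfunE p (projv M)).
  exact: memv_img (memvf _).
have fY x : x \in M -> x \in Y -> f x \in Y.
  move=> xM xY; have : f x \in (f @: (M :&: (Fl 0%N + Y)))%VS.
    by apply: memv_img; apply/memv_capP; split=> //; rewrite F0 add0v.
  by rewrite hf // F0 add0v => /memv_capP[].
pose fp := (p \o f \o s)%VF.
have fpE x : x \in M -> fp (p x) = p (f x).
  move=> xM; rewrite comp_lfunE comp_lfunE; apply/eqP; rewrite -subr_eq0 -!linearB /=.
  apply/eqP; apply: pY; apply: fY; first by rewrite memvB ?sM.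
  by apply: pker; rewrite linearB /= sK ?subrr // memv_img.
have fpB : (fp @: B = p @: (f @: M))%VS.
  apply/vspaceP => z; apply/memv_imgP/memv_imgP => [[_ /memv_imgP[x xM ->] ->]|[_ /memv_imgP[x xM ->] ->]].
    by exists (f x); rewrite ?memv_img ?fpE.
  by exists (p x); rewrite ?memv_img ?fpE.
have kp (W : {vspace V}) : (W :&: lker p = W :&: Y)%VS.
  apply/vspaceP => z; rewrite !memv_cap memv_ker; congr (_ && _).
  by apply/eqP/idP => [/pker|/pY].
have Y0 : (Y = Fl 0%N + Y)%VS by rewrite F0 add0v.
have kf : (M :&: lker f = 0)%VS.
  apply/eqP; rewrite -dimv_eq0; move: (limg_ker_dim f M); rewrite dM => /eqP.
  by rewrite -{2}[\dim M]add0n eqn_add2r.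
have dimf U : (U <= M)%VS -> \dim (f @: U) = \dim U.
  by move=> UB; apply: limg_dim_eq; apply/eqP; rewrite -subv0 -kf; apply: capvS.
have dB : \dim (fp @: B) = \dim B.
  have e1 := limg_ker_dim p M; have e2 := limg_ker_dim p (f @: M).
  rewrite fpB; apply/eqP; rewrite -(eqn_add2l (\dim ((f @: M) :&: lker p))) e2 dM -e1 !kp.
  by rewrite {2}Y0 -hf // dimf ?capvSl // -Y0.
have BX : (B <= Fl m)%VS by rewrite Fm; apply/subvP => _ /memv_imgP[x _ ->].
have fBX : (fp @: B <= Fl m)%VS.
  by rewrite Fm fpB; apply/subvP => _ /memv_imgP[x _ ->].
have [|g [gB gF]] := extend_flag_iso mono BX fBX dB.
  move=> d dm; apply/eqP; rewrite eqEsubv; apply/andP; split; apply/subvP => z.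
    case/memv_imgP => b /memv_capP[/memv_imgP[x xM Eb] bF] ->; subst b.
    rewrite fpE //; apply/memv_capP; split; first by rewrite fpB !memv_img.
    have : f x \in (f @: (M :&: (Fl d + Y)))%VS.
      by apply: memv_img; apply/memv_capP; split=> //; rewrite memFY.
    by rewrite hf // => /memv_capP[_]; rewrite memFY.
  rewrite fpB => /memv_capP[/memv_imgP[y yM ->]]; rewrite -memFY // => yF.
  have : y \in (f @: (M :&: (Fl d + Y)))%VS by rewrite hf //; apply/memv_capP.
  case/memv_imgP => x /memv_capP[xM xF] ->; rewrite -fpE //; apply: memv_img.
  by apply/memv_capP; split; rewrite ?memv_img // -memFY.
exists g; split=> // x xM; rewrite gB ?memv_img // fpE //.
Qed.
End Extension.

(** * Square roots of invertible matrices *)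

From mathcomp Require Import complex ring all_classical all_reals.

Section SquareRoot.
Variable F : numClosedFieldType.

Lemma quadratic_root (a b c : F) : (a != 0) || (b != 0) ->
  exists t, a * t ^+ 2 + b * t *+ 2 + c = 0.
Proof.
have [->|a0] := eqVneq a 0.
  move=> /= b0; exists (- c / (b *+ 2)).
  rewrite mul0r add0r -mulrnAl mulrC divfK ?addNr //.
  by rewrite -mulr_natr mulf_neq0 // pnatr_eq0.
move=> _; pose s := sqrtC (b ^+ 2 - a * c).
exists ((s - b) / a).
have E : s ^+ 2 = b ^+ 2 - a * c by rewrite sqrtCK.
apply: (mulfI a0); rewrite mulr0.
have -> : a * (a * ((s - b) / a) ^+ 2 + b * ((s - b) / a) *+ 2 + c)
   = s ^+ 2 - b ^+ 2 + a * c by field.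
by rewrite E; ring.
Qed.

(** Given p with q dividing p^2 - X, say p^2 - X = q r, one looks for a constant t
    such that p + t q works for q (X - z). As
    (p + t q)^2 - X = q (t^2 q + 2 t p + r), it must solve a quadratic equation
    at z, of which the two leading coefficients do not both vanish:
    if q(z) = 0 then p(z)^2 = z, which is nonzero. *)
Lemma sqrt_X_mod (rs : seq F) : 0 \notin rs ->
  exists p : {poly F}, \prod_(z <- rs) ('X - z%:P) %| p ^+ 2 - 'X.
Proof.
elim: rs => [_|z rs ih]; first by exists 0; rewrite big_nil dvd1p.
rewrite inE negb_or eq_sym => /andP[z0 /ih[p /dvdpP[r Er]]].
set q := \prod_(z <- rs) ('X - z%:P) in Er *.
have [t Et] : exists t, q.[z] * t ^+ 2 + p.[z] * t *+ 2 + r.[z] = 0.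
  apply: quadratic_root; have [q0|//] := eqVneq q.[z] 0; apply/eqP => p0.
  have := congr1 (fun s : {poly F} => s.[z]) Er; rewrite !hornerE p0 q0 mulr0 expr0n /= sub0r.
  by move/eqP; rewrite oppr_eq0 (negPf z0).
exists (p + t *: q).
have -> : (p + t *: q) ^+ 2 - 'X = q * (t ^+ 2 *: q + t *: p *+ 2 + r).
  have -> : (p + t *: q) ^+ 2 - 'X = (p ^+ 2 - 'X) + (t *: q) * (p *+ 2 + t *: q) by ring.
  rewrite Er -!mul_polyC rmorphXn /=; move: (t%:P) (q) => T q1; ring.
rewrite big_cons mulrC dvdp_mul // dvdp_XsubCl; apply/rootP.
by rewrite 2!hornerD hornerMn !hornerZ -Et; ring.
Qed.

(** The induction principle in the conclusion is that of Horner evaluation: it says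
    that c is a polynomial in a. *)
Lemma sqrt_mx m (a : 'M[F]_m) : a \in unitmx ->
  exists2 c : 'M[F]_m, c *m c = a &
    forall Q : 'M[F]_m -> Prop, Q 0 -> (forall b t, Q b -> Q (b *m a + t%:M)) -> Q c.
Proof.
case: m a => [|m] a ua.
  by exists 0 => //; apply/matrixP => - [].
have [rs Ers] := closed_field_poly_normal (char_poly a).
rewrite (monicP (char_poly_monic a)) scale1r in Ers.
have rs0 : 0 \notin rs.
  rewrite -root_prod_XsubC -Ers -eigenvalue_root_char; apply/eigenvalueP => - [v va v0].
  have : v = 0 by rewrite -(mulmxK ua v) va scale0r mul0mx.
  by move/eqP; rewrite (negPf v0).
have [p] := sqrt_X_mod rs0.
rewrite -Ers => /dvdpP[r Er].
exists (horner_mx a p).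
  have := congr1 (horner_mx a) Er.
  rewrite expr2 rmorphB !rmorphM /= Cayley_Hamilton mulr0 horner_mx_X => /eqP.
  by rewrite subr_eq0 => /eqP.
move=> Q Q0 QS; elim/poly_ind: p {Er} => [|p t ih]; first by rewrite rmorph0.
by rewrite rmorphD rmorphM /= horner_mx_X horner_mx_C; apply: QS.
Qed.
End SquareRoot.

(** * The symplectic form and orthogonal subspaces *)

Section SymplecticForm.
Variables (F : fieldType) (n : nat).
Local Notation V := 'cV[F]_(n + n).
Local Notation J := (sympl_mx F n).
Implicit Types (g : 'M[F]_(n + n)) (A U W : {vspace V}) (u v x y : V).

Definition om u v : F := (u^T *m J *m v) 0 0.

Lemma omE u v : u^T *m J *m v = (om u v)%:M.
Proof. by rewrite [LHS]mx11_scalar. Qed.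

Lemma omDl u v x : om (u + v) x = om u x + om v x.
Proof. by rewrite /om linearD /= !mulmxDl mxE. Qed.
Lemma omZl k u x : om (k *: u) x = k * om u x.
Proof. by rewrite /om linearZ /= -!scalemxAl mxE. Qed.
Lemma omDr x u v : om x (u + v) = om x u + om x v.
Proof. by rewrite /om mulmxDr mxE. Qed.
Lemma omZr k u x : om x (k *: u) = k * om x u.
Proof. by rewrite /om -scalemxAr mxE. Qed.
Lemma om0r x : om x 0 = 0. Proof. by rewrite /om mulmx0 mxE. Qed.
Lemma omNr x u : om x (- u) = - om x u.
Proof. by rewrite -scaleN1r omZr mulN1r. Qed.
Lemma omNl x u : om (- x) u = - om x u.
Proof. by rewrite -scaleN1r omZl mulN1r. Qed.

Lemma trJ : J^T = - J.
Proof. by rewrite /sympl_mx tr_block_mx opp_block_mx !trmx0 linearN /= trmx1 oppr0 opprK. Qed.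

Lemma JJ : J *m J = - 1%:M.
Proof.
rewrite /sympl_mx mulmx_block !mul0mx !mulmx0 !mulmx1 !mul1mx !addr0 !add0r.
by rewrite [1%:M in RHS]scalar_mx_block opp_block_mx oppr0.
Qed.

Lemma om_skew u v : om v u = - om u v.
Proof.
have -> : om v u = ((v^T *m J *m u)^T) 0 0 by rewrite mxE.
by rewrite !trmx_mul trmxK trJ mulmxA mulmxN mulNmx mxE.
Qed.

Lemma om_nondeg v : (forall u, om u v = 0) -> v = 0.
Proof.
move=> h; have Jv : J *m v = 0.
  by apply/colP => i; have := h (delta_mx i 0); rewrite /om trmx_delta -mulmxA -rowE !mxE.
have : J *m (J *m v) = 0 by rewrite Jv mulmx0.
by rewrite mulmxA JJ mulNmx mul1mx => /eqP; rewrite oppr_eq0 => /eqP.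
Qed.

(** The adjoint for the symplectic form, as the inverse of its matrix J is - J. *)
Definition adj_mx g : 'M[F]_(n + n) := - (J *m g^T *m J).

Lemma om_adj g u v : om (adj_mx g *m u) v = om u (g *m v).
Proof.
rewrite /om /adj_mx trmx_mul linearN /= !trmx_mul trmxK trJ !(mulNmx, mulmxN) !opprK.
by rewrite -!mulmxA [J *m (J *m v)]mulmxA JJ mulNmx mul1mx !mulmxN opprK.
Qed.

Lemma SpP g : Sp F n g <-> forall u v, om (g *m u) (g *m v) = om u v.
Proof.
split=> [gSp u v|h].
  by rewrite /om trmx_mul -!mulmxA [J *m _]mulmxA [g^T *m _]mulmxA [g^T *m _]mulmxA gSp mulmxA.
have ent (B : 'M[F]_(n + n)) i j :
    ((delta_mx i 0 : V)^T *m B *m (delta_mx j 0 : V)) 0 0 = B i j.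
  by rewrite trmx_delta -rowE -colE !mxE.
apply/matrixP => i j; have := h (delta_mx i 0) (delta_mx j 0).
by rewrite /om ent => <-; rewrite -[LHS]ent trmx_mul !mulmxA.
Qed.

Definition basis_mx U : 'M[F]_(\dim U, n + n) := \matrix_(i, j) (vbasis U)`_i j 0.

Definition perp U : {vspace V} := lker (linfun (mulmx (basis_mx U *m J))).

Lemma om_suml (I : finType) (f : I -> V) v : om (\sum_i f i) v = \sum_i om (f i) v.
Proof.
by apply: (big_morph (fun u => om u v)) => [u w|]; rewrite ?omDl // -(scale0r 0) omZl mul0r.
Qed.

Lemma mem_perpP U v : reflect (forall u, u \in U -> om u v = 0) (v \in perp U).
Proof.
have rowB i : row i (basis_mx U) = ((vbasis U)`_i)^T by apply/rowP => j; rewrite !mxE.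
have omB i : (basis_mx U *m J *m v) i 0 = om (vbasis U)`_i v.
  by rewrite /om -rowB -!row_mul [RHS]mxE.
rewrite memv_ker lfunE /=; apply: (iffP eqP) => [Bv u uU|h].
  rewrite (coord_vbasis uU) om_suml big1 // => i _.
  by rewrite omZl -omB Bv mxE mulr0.
apply/colP => i; rewrite omB h ?mxE // vbasis_mem // mem_nth // size_tuple.
exact: ltn_ord.
Qed.

Lemma basis_mx_free U : row_free (basis_mx U).
Proof.
rewrite -kermx_eq0; apply/eqP/row_matrixP => k; rewrite row0.
have : row k (kermx (basis_mx U)) *m basis_mx U = 0.
  by rewrite -row_mul mulmx_ker row0.
move: (row k _) => w wB; apply/rowP => i; rewrite [RHS]mxE.
have /freeP/(_ (fun i => w 0 i)) E := basis_free (vbasisP U); apply: E.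
apply/colP => j; move/rowP: wB => /(_ j); rewrite !mxE => E0.
by rewrite -[RHS]E0 summxE; apply: eq_bigr => l _; rewrite !mxE.
Qed.

Lemma dim_perp U : (\dim U + \dim (perp U) = n + n)%N.
Proof.
set f := linfun (mulmx (basis_mx U *m J)) : 'Hom(V, 'cV[F]_(\dim U)).
have dV : \dim {:V} = (n + n)%N by rewrite dimvf /dim /= muln1.
apply: etrans dV; have := limg_ker_dim f fullv; rewrite capfv -/(perp U) addnC => <-.
congr (_ + _)%N.
have -> : limg f = fullv.
  apply/eqP; rewrite eqEsubv subvf; apply/subvP => w _.
  have rf : row_free (basis_mx U *m J).
    rewrite /row_free mxrankMfree; first exact: basis_mx_free.
    rewrite row_free_unit; have [] // := @mulmx1_unit _ _ J (- J).
    by rewrite mulmxN JJ opprK.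
  have -> : w = f (pinvmx (basis_mx U *m J) *m w) by rewrite lfunE /= mulmxA mulmxVp // mul1mx.
  exact: memv_img (memvf _).
by rewrite dimvf /dim /= muln1.
Qed.

Lemma perpK U : perp (perp U) = U.
Proof.
apply/esym/eqP; rewrite eqEdim; apply/andP; split.
  apply/subvP => u uU; apply/mem_perpP => v /mem_perpP vU.
  by rewrite om_skew vU // oppr0.
by rewrite -(leq_add2l (\dim (perp U))) dim_perp addnC dim_perp.
Qed.

Lemma isotropicP U : isotropic U <-> (U <= perp U)%VS.
Proof.
split=> [h|/subvP h u v uU vU].
  apply/subvP => v vU; apply/mem_perpP => u uU.
  by rewrite /om h // mxE.
by rewrite omE (mem_perpP _ _ (h v vU)) // raddf0.
Qed.

Lemma lagrangian_perp U : lagrangian U -> perp U = U.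
Proof.
case=> /isotropicP h d; apply/esym/eqP; rewrite eqEdim h /=.
by have := dim_perp U; rewrite d => /eqP; rewrite eqn_add2l => /eqP->.
Qed.
End SymplecticForm.

(** * Isometries of a polarized symplectic space *)

Section MatrixAction.
Variables (F : fieldType) (n : nat).
Local Notation V := 'cV[F]_(n + n).
Local Notation lmx g := (linfun (mulmx g) : 'End(V)).
Implicit Types (g : 'M[F]_(n + n)) (A U W : {vspace V}) (u v x y : V).

Lemma lmxE g x : lmx g x = g *m x.
Proof. by rewrite lfunE. Qed.

Lemma mem_lmx g A x : x \in A -> g *m x \in (lmx g @: A)%VS.
Proof. by move=> xA; rewrite -lmxE memv_img. Qed.

Lemma lmxM g h A : (lmx (g *m h) @: A = lmx g @: (lmx h @: A))%VS.
Proof.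
rewrite -limg_comp; apply: eq_limg => x _.
by rewrite comp_lfunE !lmxE mulmxA.
Qed.

Lemma lmx1 A : (lmx 1%:M @: A = A)%VS.
Proof.
rewrite -[RHS]lim1g; apply: eq_limg => x _.
by rewrite lmxE mul1mx id_lfunE.
Qed.

Lemma lmxK g A : g \in unitmx -> (lmx (invmx g) @: (lmx g @: A) = A)%VS.
Proof. by move=> ug; rewrite -lmxM mulVmx // lmx1. Qed.

Lemma dim_lmx g A : g \in unitmx -> \dim (lmx g @: A) = \dim A.
Proof.
move=> ug; apply: limg_dim_eq; apply/eqP; rewrite -subv0; apply/subvP => x /memv_capP[_].
by rewrite memv_ker lmxE => /eqP gx; rewrite -(mulKmx ug x) gx mulmx0 mem0v.
Qed.

Lemma lmx_stable g A : g \in unitmx -> (forall x, x \in A -> g *m x \in A) -> (lmx g @: A = A)%VS.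
Proof.
move=> ug gA; apply/eqP; rewrite eqEdim dim_lmx // leqnn andbT.
by apply/subvP => _ /memv_imgP[x xA ->]; rewrite lmxE gA.
Qed.

Lemma lmx_full_unit g : (lmx g @: fullv = fullv)%VS -> g \in unitmx.
Proof.
move=> gT; have := limg_ker_dim (lmx g) fullv; rewrite gT capfv => /eqP.
rewrite -{2}[\dim {:V}]add0n eqn_add2r dimv_eq0 => /eqP k0.
rewrite -unitmx_tr -row_free_unit; apply: inj_row_free => w wg.
have : w^T \in lker (lmx g) by rewrite memv_ker lmxE -trmx0 -wg trmx_mul trmxK.
by rewrite k0 memv0 => /eqP /(congr1 trmx); rewrite trmxK trmx0.
Qed.

Lemma lmxV_stable g A : g \in unitmx -> (lmx g @: A = A)%VS -> (lmx (invmx g) @: A = A)%VS.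
Proof. by move=> ug {1}<-; rewrite lmxK. Qed.

Lemma stabilizesP g A : g \in unitmx -> stabilizes g A <-> (lmx g @: A = A)%VS.
Proof.
move=> ug; rewrite /stabilizes; split=> [gA|->] //; apply/eqP.
by rewrite eqEdim dim_lmx // leqnn andbT.
Qed.

Lemma lfun_mx (f : 'End(V)) : exists g, forall x, f x = g *m x.
Proof.
exists (\matrix_(i, j) (f (delta_mx j 0)) i 0) => x.
rewrite {1}[x]matrix_sum_delta linear_sum /=; apply/colP => i.
rewrite summxE [RHS]mxE; apply: eq_bigr => j _.
by rewrite big_ord1 linearZ /= !mxE mulrC.
Qed.

Lemma J_unit : sympl_mx F n \in unitmx.
Proof.
have [] // := @mulmx1_unit _ _ (sympl_mx F n) (- sympl_mx F n).
by rewrite mulmxN JJ opprK.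
Qed.

Lemma adj_unit g : g \in unitmx -> adj_mx g \in unitmx.
Proof.
move=> ug; rewrite /adj_mx -scaleN1r unitmxZ ?unitrN1 //.
by rewrite !unitmx_mul J_unit unitmx_tr ug.
Qed.

Lemma Sp_unit g : Sp F n g -> g \in unitmx.
Proof.
move=> /= gSp; have := J_unit.
by rewrite -{1}gSp !unitmx_mul => /andP[].
Qed.

Lemma perp_Sp g A : Sp F n g -> perp (lmx g @: A) = (lmx g @: perp A)%VS.
Proof.
move=> gSp; have ug := Sp_unit gSp; have /SpP om_g := gSp.
apply/vspaceP => v; rewrite -(mulKVmx ug v).
apply/mem_perpP/idP => [h|].
  apply: mem_lmx; apply/mem_perpP => u uA.
  by rewrite -om_g; apply: h; apply: mem_lmx.
case/memv_imgP => w /mem_perpP wA; rewrite lmxE => -> _ /memv_imgP[u uA ->].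
by rewrite lmxE om_g wA.
Qed.

Lemma isotropic_Sp g A : Sp F n g -> isotropic A -> isotropic (lmx g @: A)%VS.
Proof. by move=> gSp /isotropicP h; apply/isotropicP; rewrite perp_Sp // limgS. Qed.

Lemma Sp_mul g h : Sp F n g -> Sp F n h -> Sp F n (g *m h).
Proof. by move=> /SpP gS /SpP hS; apply/SpP => u v; rewrite -!mulmxA gS hS. Qed.

Lemma Sp_inv g : Sp F n g -> Sp F n (invmx g).
Proof.
move=> gSp; have ug := Sp_unit gSp; have /SpP om_g := gSp.
by apply/SpP => u v; rewrite -om_g !mulKVmx.
Qed.

Variables Vp Vm : {vspace V}.
Hypothesis hV : polarization Vp Vm.

Lemma polar_perp : [/\ perp Vp = Vp, perp Vm = Vm, (Vp :&: Vm = 0)%VS & (Vp + Vm = fullv)%VS].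
Proof. by have [lp lm i s] := hV; split=> //; apply: lagrangian_perp. Qed.

Lemma polar_split x : exists2 y, y \in Vp & exists2 z, z \in Vm & x = y + z.
Proof. by have [_ _ _ s] := hV; apply/memv_addP; rewrite s memvf. Qed.

Lemma om_pp x y : x \in Vp -> y \in Vp -> om x y = 0.
Proof. by have [e _ _ _] := polar_perp; move=> xV; rewrite -{1}e => /mem_perpP; apply. Qed.
Lemma om_mm x y : x \in Vm -> y \in Vm -> om x y = 0.
Proof. by have [_ e _ _] := polar_perp; move=> xV; rewrite -{1}e => /mem_perpP; apply. Qed.

(** Extend f by the identity on V-, to G. The adjoint of G is the identity on V+
    and preserves V-, so G composed with the inverse of its adjoint acts as f on
    V+ and as the inverse of the adjoint of f on V-. *)
Lemma GL_polar_of_lfun (f : 'End(V)) : (f @: Vp = Vp)%VS ->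
  exists2 h, GL_polar Vp Vm h & forall x, x \in Vp -> h *m x = f x.
Proof.
have [pp pm pi ps] := polar_perp.
move=> fV; have [f1 [f1p f1m]] := glue_lfun f \1%VF pi.
have [G GE] := lfun_mx f1.
have Gp x : x \in Vp -> G *m x = f x by move=> xV; rewrite -GE f1p.
have Gm x : x \in Vm -> G *m x = x by move=> xV; rewrite -GE f1m // id_lfunE.
have fp x : x \in Vp -> f x \in Vp by move=> xV; rewrite -fV memv_img.
have GT : (lmx G @: fullv = fullv)%VS.
  rewrite -{1}ps limgD -[RHS]ps; congr (_ + _)%VS.
    by rewrite -{2}fV; apply: eq_limg => x xV; rewrite lmxE Gp.
  by rewrite -{2}[Vm]lim1g; apply: eq_limg => x xV; rewrite lmxE Gm // id_lfunE.
have uG : G \in unitmx.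
  exact: lmx_full_unit.
have ua := adj_unit uG.
have ap x : x \in Vp -> adj_mx G *m x = x.
  move=> xV; apply/eqP; rewrite -subr_eq0; apply/eqP/om_nondeg => y.
  rewrite om_skew omDl omNl om_adj; have [y1 y1V [y2 y2V ->]] := polar_split y.
  by rewrite mulmxDr !omDr Gp // (Gm y2) // (om_pp xV (fp _ y1V)) (om_pp xV y1V) !add0r subrr oppr0.
have am x : x \in Vm -> adj_mx G *m x \in Vm.
  move=> xV; rewrite -pm; apply/mem_perpP => y yV.
  by rewrite om_skew om_adj Gm // om_mm // oppr0.
have aVm := lmx_stable ua am.
have aVm' x : x \in Vm -> invmx (adj_mx G) *m x \in Vm.
  by move=> xV; rewrite -(lmxV_stable ua aVm) mem_lmx.
pose h := G *m invmx (adj_mx G).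
have hp x : x \in Vp -> h *m x = f x.
  by move=> xV; rewrite /h -mulmxA -{1}(ap x xV) mulKmx // Gp.
have hm x : x \in Vm -> h *m x = invmx (adj_mx G) *m x.
  by move=> xV; rewrite /h -mulmxA Gm // aVm'.
have hpm x y : x \in Vp -> y \in Vm -> om (h *m x) (h *m y) = om x y.
  move=> xV yV; rewrite hp // hm // -Gp // om_skew -om_adj mulKVmx // -om_skew //.
have hpmem x : x \in Vp -> h *m x \in Vp by move=> xV; rewrite hp // fp.
have hmmem x : x \in Vm -> h *m x \in Vm by move=> xV; rewrite hm // aVm'.
exists h => //; split.
- apply/SpP => u v; have [u1 u1V [u2 u2V ->]] := polar_split u.
  have [v1 v1V [v2 v2V ->]] := polar_split v.
  rewrite !mulmxDr !(omDl, omDr) (hpm u1 v2) // [om (h *m u2) (h *m v1)]om_skew (hpm v1 u2) // -om_skew.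
  rewrite (om_pp u1V v1V) (om_mm u2V v2V) (om_pp (hpmem _ u1V) (hpmem _ v1V)).
  by rewrite (om_mm (hmmem _ u2V) (hmmem _ v2V)).
- by apply/subvP => _ /memv_imgP[x xV ->]; rewrite lmxE hpmem.
- by apply/subvP => _ /memv_imgP[x xV ->]; rewrite lmxE hmmem.
Qed.

End MatrixAction.

(** The adjoint square a of g maps A to itself, because g maps A and its orthogonal
    to A' and its orthogonal, and double orthogonals are trivial. A square root c
    of a that is a polynomial in a is self-adjoint and maps A to itself, and g c^-1
    preserves the form. *)
Lemma symplectize (F : numClosedFieldType) n (g : 'M[F]_(n + n)) : g \in unitmx ->
  exists2 k, Sp F n k & forall A A' : {vspace 'cV[F]_(n + n)},
    (linfun (mulmx g) @: A = A')%VS -> (linfun (mulmx g) @: perp A = perp A')%VS ->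
    (linfun (mulmx k) @: A = A')%VS.
Proof.
move=> ug; have [a aE] : exists a, a = adj_mx g *m g by eexists.
have ua : a \in unitmx by rewrite aE unitmx_mul adj_unit.
have om_a u v : om (a *m u) v = om (g *m u) (g *m v) by rewrite aE -mulmxA om_adj.
have om_a' u v : om u (a *m v) = om (g *m u) (g *m v) by rewrite om_skew om_a -om_skew.
have [c cc cind] := sqrt_mx ua.
have uc : c \in unitmx by move: ua; rewrite -cc unitmx_mul => /andP[].
have [om_c _] : (forall u v, om (c *m u) v = om u (c *m v)) /\ c *m a = a *m c.
  apply: (cind (fun b => (forall u v, om (b *m u) v = om u (b *m v)) /\ b *m a = a *m b))
    => [|b t [om_b ba]].
    by split=> [u v|]; rewrite !(mul0mx, mulmx0) // om0r om_skew om0r oppr0.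
  split=> [u v|]; last first.
    by rewrite mulmxDl mulmxDr scalar_mxC; congr (_ + _); rewrite mulmxA -ba.
  rewrite !mulmxDl !mul_scalar_mx omDl omDr omZl omZr; congr (_ + _).
  by rewrite -mulmxA om_b om_a -om_a' mulmxA -ba.
exists (g *m invmx c).
  apply/SpP => u v; rewrite -(mulKVmx uc u) -(mulKVmx uc v).
  move: (invmx c *m u) (invmx c *m v) => {}u {}v.
  by rewrite -!mulmxA !mulKmx // -om_a -cc -mulmxA om_c.
move=> A A' gA gpA; rewrite lmxM.
have aA x : x \in A -> a *m x \in A.
  move=> xA; rewrite -[A]perpK; apply/mem_perpP => y yA.
  rewrite om_a'; have : g *m y \in perp A' by rewrite -gpA mem_lmx.
  by move/mem_perpP => h; rewrite om_skew h ?oppr0 // -gA mem_lmx.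
have cA x : x \in A -> c *m x \in A.
  move: x; apply: (cind (fun b => forall x, x \in A -> b *m x \in A)) => [x _|b t ih x xA]; first by rewrite mul0mx mem0v.
  by rewrite mulmxDl mul_scalar_mx -mulmxA memvD ?memvZ // ih ?aA.
by rewrite (lmxV_stable uc (lmx_stable uc cA)).
Qed.

(** * From orbits to invariants of isotropic subspaces *)

Section Orbits.
Variables (F : fieldType) (n : nat).
Local Notation V := 'cV[F]_(n + n).
Local Notation lmx g := (linfun (mulmx g) : 'End(V)).
Implicit Types (g k : 'M[F]_(n + n)) (U : {vspace V}).
Variables (Vp Vm : {vspace V}) (T : set nat) (E Fl : nat -> {vspace V}) (i : nat).
Hypotheses (dE : \dim (E i) = i) (iE : isotropic (E i)).
Local Notation G := (Sp F n).
Local Notation K := (GL_polar Vp Vm).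
Local Notation P := (flag_stabilizer G [set i]%classic E).
Local Notation Q := (flag_stabilizer K T Fl).

Lemma GL_polar_Sp k : K k -> G k. Proof. by case. Qed.

Lemma stabilizes_mul g h U : stabilizes g U -> stabilizes h U -> stabilizes (g *m h) U.
Proof.
by rewrite /stabilizes lmxM => gU hU; apply: subv_trans gU; apply: limgS.
Qed.

Lemma stabilizes_inv g U : g \in unitmx -> stabilizes g U -> stabilizes (invmx g) U.
Proof.
move=> ug /(stabilizesP _ ug) gU; apply/stabilizesP; rewrite ?unitmx_inv //.
exact: lmxV_stable.
Qed.

Lemma GL_polar_mul g h : K g -> K h -> K (g *m h).
Proof.
by move=> [g1 g2 g3] [h1 h2 h3]; split; [exact: Sp_mul|exact: stabilizes_mul|exact: stabilizes_mul].
Qed.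

Lemma GL_polar_inv g : K g -> K (invmx g).
Proof.
move=> [g1 g2 g3]; have ug := Sp_unit g1.
by split; [exact: Sp_inv|exact: stabilizes_inv|exact: stabilizes_inv].
Qed.

Lemma ltranslateM m (g h : 'M[F]_m) (A : set 'M[F]_m) :
  ltranslate g (ltranslate h A) = ltranslate (g *m h) A.
Proof.
apply/seteqP; split=> x.
  by case=> _ [y yA <-] <-; exists y; rewrite ?mulmxA.
by case=> y yA <-; exists (h *m y); rewrite ?mulmxA //; exists y.
Qed.

Lemma ltranslate_stab g g' : G g -> G g' -> (lmx g @: E i = lmx g' @: E i)%VS ->
  ltranslate g P = ltranslate g' P.
Proof.
have sub h h' : G h -> G h' -> (lmx h @: E i = lmx h' @: E i)%VS ->
    (ltranslate h P `<=` ltranslate h' P)%classic.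
  move=> hG hG' eqE _ [p [pG pE] <-].
  have uh := Sp_unit hG; have uh' := Sp_unit hG'.
  exists (invmx h' *m (h *m p)); last by rewrite mulKVmx.
  split; first by apply: Sp_mul (Sp_inv hG') (Sp_mul hG pG).
  move=> d /= ->; apply/stabilizesP.
    by rewrite !unitmx_mul unitmx_inv uh uh' (Sp_unit pG).
  have /(stabilizesP _ (Sp_unit pG)) pEi := pE i erefl.
  by rewrite !lmxM pEi eqE lmxK.
move=> gG gG' eqE; apply/seteqP; split; exact: sub.
Qed.

Lemma ltranslate_flag_stab k : Q k -> ltranslate k Q = Q.
Proof.
move=> [kK kF]; have uk := Sp_unit (GL_polar_Sp kK).
apply/seteqP; split=> [_ [q [qK qF] <-]|q [qK qF]].
  split; first exact: GL_polar_mul.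
  by move=> d dT; apply: stabilizes_mul; [apply: kF | apply: qF].
exists (invmx k *m q); last by rewrite mulKVmx.
split; first exact: GL_polar_mul (GL_polar_inv kK) qK.
by move=> d dT; apply: stabilizes_mul (qF d dT); apply: stabilizes_inv (kF d dT).
Qed.

Lemma diag_orbit_translate k x : K k ->
  diag_orbit K (ltranslate k x.1, ltranslate k x.2) = diag_orbit K x.
Proof.
move=> kK; have uk := Sp_unit (GL_polar_Sp kK).
apply/seteqP; split=> [_ [h hK <-]|_ [h hK <-]] /=.
  by exists (h *m k); [exact: GL_polar_mul | rewrite !ltranslateM].
exists (h *m invmx k); first exact: GL_polar_mul hK (GL_polar_inv kK).
by rewrite !ltranslateM mulmxKV.
Qed.

(** Every orbit contains a point (Q, g P), and the coset g P is determined by the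
    isotropic subspace g E_i; so an orbit is determined by any code of g E_i. *)
Lemma finite_orbits_of_codes (CT : finType) (code : {vspace V} -> CT -> Prop) :
  (forall U, isotropic U -> \dim U = i -> exists c, code U c) ->
  (forall U U' c, isotropic U -> isotropic U' -> \dim U = i -> \dim U' = i ->
     code U c -> code U' c -> exists2 k, Q k & (lmx k @: U = U')%VS) ->
  finitely_many_orbits K (double_flag_variety K Q G P).
Proof.
move=> ex_code same_code.
pose X := double_flag_variety K Q G P.
have norm x : X x -> exists2 g, G g & diag_orbit K x = diag_orbit K (Q, ltranslate g P).
  case: x => x1 x2 [/= [k kK <-] [g gG <-]].
  have kV := GL_polar_inv kK; have uk := Sp_unit (GL_polar_Sp kK).
  exists (invmx k *m g); first exact: Sp_mul (GL_polar_Sp kV) gG.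
  rewrite -(diag_orbit_translate _ kV) /= !ltranslateM mulVmx //.
  congr (diag_orbit K (_, _)); apply/seteqP; split=> q.
    by case=> q' q'Q <-; rewrite mul1mx.
  by move=> qQ; exists q => //; rewrite mul1mx.
pose rep (c : CT) (O : set (set 'M[F]_(n + n) * set 'M[F]_(n + n))) :=
  exists g, [/\ G g, code (lmx g @: E i)%VS c & O = diag_orbit K (Q, ltranslate g P)].
have iso g : G g -> isotropic (lmx g @: E i)%VS /\ \dim (lmx g @: E i) = i.
  by move=> gG; split; [exact: isotropic_Sp | rewrite dim_lmx ?Sp_unit].
have rep_uniq c O O' : rep c O -> rep c O' -> O = O'.
  move=> [g [gG cg ->]] [g' [gG' cg' ->]].
  have [ig dg] := iso g gG; have [ig' dg'] := iso g' gG'.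
  have [k kQ kE] := same_code _ _ _ ig ig' dg dg' cg cg'.
  have kK : K k by case: kQ.
  rewrite -(diag_orbit_translate (Q, ltranslate g P) kK) /= ltranslate_flag_stab //.
  rewrite ltranslateM; congr (diag_orbit K (_, _)); apply: ltranslate_stab => //.
    exact: Sp_mul (GL_polar_Sp kK) gG.
  by rewrite lmxM kE.
have /choice [sel selP] : forall c, exists O, forall O', rep c O' -> O' = O.
  move=> c; case: (pselect (exists O, rep c O)) => [[O rO]|nO].
    by exists O => O' rO'; apply: rep_uniq rO' rO.
  by exists set0 => O' rO'; case: nO; exists O'.
apply: (@sub_finite_set _ _ (sel @` [set: CT])%classic).
  move=> _ [x xX <-]; have [g gG Ex] := norm x xX.
  have [ig dg] := iso g gG; have [c cg] := ex_code _ ig dg.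
  by exists c => //; apply/esym/selP; exists g.
by apply: finite_image; apply: finite_finset.
Qed.
End Orbits.

(** * Finiteness in the three cases *)

Section Main.
Variables (F : numClosedFieldType) (n : nat).
Local Notation V := 'cV[F]_(n + n).
Local Notation lmx g := (linfun (mulmx g) : 'End(V)).
Variables (Vp Vm : {vspace V}).
Hypothesis hV : polarization Vp Vm.

(** Under the duality between V+ and V-, the annihilator of W. *)
Definition dual_sub (W : {vspace V}) : {vspace V} := (perp W :&: Vm)%VS.

Section Flag.
Variables (Fl : nat -> {vspace V}) (m : nat).
Hypotheses (mono : forall d e, (d <= e <= m)%N -> (Fl d <= Fl e)%VS)
  (Fl0 : Fl 0%N = 0%VS) (Flm : Fl m = Vp).

Lemma perpS (A B : {vspace V}) : (A <= B)%VS -> (perp B <= perp A)%VS.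
Proof.
move=> /subvP AB; apply/subvP => v /mem_perpP h; apply/mem_perpP => u uA.
by apply: h; apply: AB.
Qed.

Lemma flag_sub_Vp d : (d <= m)%N -> (Fl d <= Vp)%VS.
Proof. by move=> dm; rewrite -Flm mono // dm leqnn. Qed.

Lemma perp_flag d : (d <= m)%N -> perp (Fl d) = (Vp + dual_sub (Fl d))%VS.
Proof.
move=> dm; have [pp pm pi ps] := polar_perp hV.
rewrite /dual_sub capvC vspace_modl ?ps ?capfv // ?capvf.
  by rewrite -{1}pp perpS // flag_sub_Vp.
Qed.

(** Linear maps of V+ and of V- that agree on the orthogonal of U with the parts
    of f are obtained from [extend_to_summand], the flag of V- being the dual one
    in reverse order. Together they give an invertible map that has the effect
    required of k, also on all orthogonals; [symplectize] turns it into an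
    isometry. *)
Lemma flag_fixing_isometry (U U' : {vspace V}) (f : 'End(V)) :
  isotropic U -> \dim (perp U') = \dim (perp U) -> 
  (f @: perp U = perp U')%VS -> (f @: U = U')%VS ->
  (forall d, (d <= m)%N ->
     (f @: (perp U :&: (Fl d + Vm)) = perp U' :&: (Fl d + Vm))%VS /\
     (f @: (perp U :&: (dual_sub (Fl d) + Vp)) = perp U' :&: (dual_sub (Fl d) + Vp))%VS) ->
  exists k, [/\ GL_polar Vp Vm k, forall d, (d <= m)%N -> stabilizes k (Fl d) &
    (lmx k @: U = U')%VS].
Proof.
move=> /isotropicP iU dU fM fU hf; have [pp pm pi ps] := polar_perp hV.
have dM : \dim (f @: perp U) = \dim (perp U) by rewrite fM.
have [|gp [gpF gpM]] := extend_to_summand pi ps mono Fl0 Flm dM.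
  by move=> d dm; rewrite fM; case: (hf d dm).
have pi' : (Vm :&: Vp = 0)%VS by rewrite capvC.
have ps' : (Vm + Vp = fullv)%VS by rewrite addvC.
have [||||gm [gmF gmM]] := @extend_to_summand _ _ Vm Vp (fun d => dual_sub (Fl (m - d))) m f
    (perp U) pi' ps' _ _ _ dM.
- move=> d e /andP[de em]; apply: capvS => //; apply: perpS; apply: mono; lia.
- by rewrite /dual_sub subn0 Flm pp.
- rewrite /dual_sub subnn Fl0; apply/capv_idPr; apply/subvP => x _.
  by apply/mem_perpP => u; rewrite memv0 => /eqP->; rewrite om_skew om0r oppr0.
- by move=> d dm; rewrite fM; case: (hf (m - d)%N (leq_subr _ _)).
have gpV : (gp @: Vp = Vp)%VS by rewrite -Flm gpF.
have gmV : (gm @: Vm = Vm)%VS.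
  have := gmF m (leqnn m); rewrite /dual_sub subnn Fl0.
  suff -> : (perp 0 :&: Vm = Vm)%VS by [].
  apply/capv_idPr; apply/subvP => x _.
  by apply/mem_perpP => u; rewrite memv0 => /eqP->; rewrite om_skew om0r oppr0.
have [g0 [g0p g0m]] := glue_lfun gp gm pi.
have [g gE] := lfun_mx g0.
have gI (A : {vspace V}) : (lmx g @: A = g0 @: A)%VS.
  by apply: eq_limg => x _; rewrite lmxE gE.
have gA (A : {vspace V}) : (A <= Vp)%VS -> (lmx g @: A = gp @: A)%VS.
  by move=> /subvP AV; rewrite gI; apply: eq_limg => x /AV; apply: g0p.
have gA' (A : {vspace V}) : (A <= Vm)%VS -> (lmx g @: A = gm @: A)%VS.
  by move=> /subvP AV; rewrite gI; apply: eq_limg => x /AV; apply: g0m.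
have ug : g \in unitmx.
  by apply: lmx_full_unit; rewrite -ps limgD gA // gA' // gpV gmV.
have gM (A : {vspace V}) : (A <= perp U)%VS -> (lmx g @: A = f @: A)%VS.
  move=> /subvP AM; rewrite gI; apply: eq_limg => x /AM xM.
  have xs : x \in (Vp + Vm)%VS by rewrite ps memvf.
  have fs : f x \in (Vp + Vm)%VS by rewrite ps memvf.
  rewrite -{1}(daddv_pi_add pi xs) -(daddv_pi_add pi fs) linearD /=.
  by rewrite g0p ?memv_pi // g0m ?memv_pi // gpM // gmM.
have [k kSp kA] := symplectize ug.
have kVp : (lmx k @: Vp = Vp)%VS by apply: kA; rewrite ?pp gA // gpV.
have kVm : (lmx k @: Vm = Vm)%VS by apply: kA; rewrite ?pm gA' // gmV.
exists k; split.
- by split=> //; rewrite /stabilizes ?kVp ?kVm.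
- move=> d dm; rewrite /stabilizes (kA (Fl d) (Fl d)) //; first by rewrite gA ?flag_sub_Vp // gpF.
  rewrite perp_flag // limgD gA // gpV gA' ?capvSr //.
  by have := gmF (m - d)%N (leq_subr _ _); rewrite subKn // => ->.
- by apply: kA; rewrite gM.
Qed.

Lemma dim_perpE (U : {vspace V}) i : \dim U = i -> \dim (perp U) = (n + n - i)%N.
Proof. by move=> <-; rewrite -[X in (X - _)%N](dim_perp U) addKn. Qed.

Lemma mono_sum_Vm (U : {vspace V}) d : (d < m)%N ->
  (perp U :&: (Fl d + Vm) <= perp U :&: (Fl d.+1 + Vm))%VS.
Proof.
by move=> dm; apply: capvS => //; apply: addvS => //; apply: mono; rewrite leqnSn.
Qed.

Lemma mono_dual_Vp (U : {vspace V}) d e : (d <= e <= m)%N ->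
  (perp U :&: (dual_sub (Fl e) + Vp) <= perp U :&: (dual_sub (Fl d) + Vp))%VS.
Proof.
move=> de; apply: capvS => //; apply: addvS => //; apply: capvS => //.
by apply: perpS; apply: mono.
Qed.

Variables (T : set nat) (E Fo : nat -> {vspace V}).
Hypothesis FoE : forall d, T d -> exists2 d', (d' <= m)%N & Fo d = Fl d'.

Local Notation K := (GL_polar Vp Vm).
Local Notation P i := (flag_stabilizer (Sp F n) [set i]%classic E).
Local Notation Q := (flag_stabilizer K T Fo).

(** Here the orthogonal of U is U itself, which carries the two flags induced by
    those of V+ and V-. *)
Lemma finite_lagrangian : \dim (E n) = n -> isotropic (E n) ->
  finitely_many_orbits K (double_flag_variety K Q (Sp F n) (P n)).
Proof.
move=> dE iE.
pose form (U : {vspace V}) := @two_flags_form _ _ n m (perp U)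
  (fun d => perp U :&: (Fl d + Vm))%VS
  (fun d => perp U :&: (dual_sub (Fl (m - d)) + Vp))%VS.
apply: (finite_orbits_of_codes dE iE (code := form)) => [U iU dU|U U' c iU iU' dU dU' cU cU'].
  apply: two_flags_form_exists; rewrite ?capvSl //.
  - by rewrite (dim_perpE dU) addnK.
  - by move=> d; apply: mono_sum_Vm.
  - by move=> d dm; apply: mono_dual_Vp; lia.
have pE (W : {vspace V}) : isotropic W -> \dim W = n -> perp W = W.
  by move=> iW dW; apply: lagrangian_perp.
have dp : \dim (perp U) = n by rewrite (dim_perpE dU) addnK.
have [f [fM fLR]] := two_flags_form_iso dp cU cU'.
have [|||k [kK kF kU]] := flag_fixing_isometry iU _ fM.
- by rewrite !pE // dU.
- by rewrite -(pE U) // fM pE.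
- move=> d dm; split; first by have [] := fLR d dm.
  by have [_] := fLR (m - d)%N (leq_subr _ _); rewrite subKn.
exists k => //; split=> // d /FoE[d' dm ->]; exact: kF.
Qed.


Lemma limgZ (f : 'End(V)) s (A : {vspace V}) : s != 0 -> ((s *: f)%R @: A = f @: A)%VS.
Proof.
move=> s0; apply/vspaceP => y; apply/memv_imgP/memv_imgP => [][x xA ->].
  by exists (s *: x); rewrite ?memvZ // scale_lfunE linearZ.
by exists (s^-1 *: x); rewrite ?memvZ // scale_lfunE linearZ /= scalerA mulfV // scale1r.
Qed.

(** If v = 0 then also v' = 0, and any nonzero scalar will do. *)
Lemma line_scalar (f : 'End(V)) (v v' : V) : (f @: <[v]> = <[v']>)%VS ->
  exists2 al, al != 0 & f v = al *: v'.
Proof.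
rewrite limg_line => E1.
have /vlineP[al Eal] : f v \in <[v']>%VS by rewrite -E1 memv_line.
have [al0|al0] := eqVneq al 0; last by exists al.
exists 1; first exact: oner_neq0.
rewrite Eal al0 scale0r; have : v' \in <[f v]>%VS by rewrite E1 memv_line.
by rewrite Eal al0 scale0r => /vlineP[k ->]; rewrite !scaler0.
Qed.

(** The two linear forms on V+ given by w and, through f, by w' have the same
    kernel. *)
Lemma hyperplane_scalar (f : 'End(V)) (w w' : V) : (f @: Vp = Vp)%VS ->
  (f @: (perp <[w]> :&: Vp) = perp <[w']> :&: Vp)%VS ->
  exists2 be, be != 0 & forall x, x \in Vp -> om (f x) w' = be * om x w.
Proof.
move=> fV fH.
have memH x y : x \in Vp -> (x \in (perp <[y]> :&: Vp)%VS) = (om x y == 0).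
  move=> xV; rewrite memv_cap xV andbT; apply/mem_perpP/eqP => [h|h u /vlineP[k ->]].
    by rewrite om_skew h ?oppr0 // memv_line.
  by rewrite omZl om_skew h oppr0 mulr0.
have fVx x : x \in Vp -> f x \in Vp by move=> xV; rewrite -fV memv_img.
have fHx x : x \in Vp -> om x w = 0 -> om (f x) w' = 0.
  move=> xV xw; apply/eqP; rewrite -memH ?fVx // -fH memv_img // memH //; exact/eqP.
have ker0 : (Vp :&: lker f = 0)%VS.
  apply/eqP; rewrite -dimv_eq0; move: (limg_ker_dim f Vp); rewrite fV => /eqP.
  by rewrite -{2}[\dim Vp]add0n eqn_add2r.
have inj x y : x \in Vp -> y \in Vp -> f x = f y -> x = y.
  move=> xV yV fxy; apply/eqP; rewrite -subr_eq0 -memv0 -ker0 memv_cap memvB //.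
  by rewrite memv_ker linearB /= fxy subrr.
case: (pselect (exists2 x, x \in Vp & om x w != 0)) => [[x0 x0V x0w]|nx].
  exists (om (f x0) w' / om x0 w) => [|x xV].
    rewrite mulf_neq0 ?invr_eq0 //; apply/eqP => fx0.
    have : f x0 \in (f @: (perp <[w]> :&: Vp))%VS by rewrite fH memH ?fVx // fx0.
    case/memv_imgP => y yH /inj x0y; move: (yH); rewrite memv_cap => /andP[_ yV].
    by move: yH; rewrite -x0y // memH // (negPf x0w).
  have /fHx : x - (om x w / om x0 w) *: x0 \in Vp by rewrite memvB ?memvZ.
  rewrite omDl omNl omZl divfK // subrr => /(_ erefl).
  rewrite linearB linearZ /= omDl omNl omZl => /eqP; rewrite subr_eq0 => /eqP->.
  by rewrite mulrC mulrA mulrAC.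
exists 1 => [|x xV]; first exact: oner_neq0.
have x0 : om x w = 0 by apply/eqP; apply: contraT => h; case: nx; exists x.
by rewrite x0 mulr0 fHx.
Qed.

(** For U spanned by u = v + w, one matches by f the flag, the lines of v and v'
    and the hyperplanes orthogonal to w and w'. Then f v = al v', and the form on
    V+ given by w' pulls back along f to be times the one given by w. The element
    of K extending s f maps w to (s be)^-1 w', so it maps u to a multiple of u'
    when s^2 al be = 1. *)
Lemma finite_line : \dim (E 1%N) = 1%N -> isotropic (E 1%N) ->
  finitely_many_orbits K (double_flag_variety K Q (Sp F n) (P 1%N)).
Proof.
move=> dE iE; have [pp pm pi ps] := polar_perp hV.
have dVp : \dim Vp = n by have [[_ ->]] := hV.
pose p := daddv_pi Vp Vm.
pose form (U : {vspace V}) := @flag_subspaces_form _ _ n m Vp Fl (perp U :&: Vp)%VS (p @: U)%VS.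
apply: (finite_orbits_of_codes dE iE (code := form)) => [U iU dU|U U' c iU iU' dU dU' cU cU'].
  apply: flag_subspaces_form_exists; rewrite ?capvSr ?Flm //.
    by move=> d dm; apply: mono; rewrite leqnSn.
  by apply/subvP => _ /memv_imgP[x _ ->]; apply: memv_pi.
have [f [fV fF fH fp]] := flag_subspaces_form_iso dVp cU cU'.
have lineE (W : {vspace V}) : \dim W = 1%N -> exists v w, [/\ v \in Vp, w \in Vm,
    W = <[v + w]>%VS, (p @: W = <[v]>)%VS & (perp W :&: Vp = perp <[w]> :&: Vp)%VS].
  move=> dW; set u := vpick W.
  have u0 : u != 0 by rewrite vpick0 -dimv_eq0 dW.
  have WE : W = <[u]>%VS by apply/esym/eqP; rewrite eqEdim -memvE memv_pick dW dim_vline u0.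
  have us : p u + daddv_pi Vm Vp u = u by apply: daddv_pi_add; rewrite ?ps ?memvf.
  exists (p u), (daddv_pi Vm Vp u); split; rewrite ?memv_pi // ?us //.
    by rewrite WE limg_line.
  have capE x y : (x \in perp <[y]>%VS) = (om y x == 0).
    by apply/mem_perpP/eqP => [h|h _ /vlineP[k ->]]; [rewrite h ?memv_line | rewrite omZl h mulr0].
  apply/vspaceP => x; rewrite !memv_cap WE !capE; case xV: (x \in Vp); rewrite ?andbF // !andbT.
  by rewrite -[in LHS]us omDl (om_pp hV _ xV) ?memv_pi // add0r.
have [v [w [vV wV UE pU HU]]] := lineE U dU.
have [v' [w' [v'V w'V UE' pU' HU']]] := lineE U' dU'.
rewrite pU pU' in fp; rewrite HU HU' in fH.
have [al al0 fv] := line_scalar fp.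
have [be be0 fw] := hyperplane_scalar fV fH.
pose s := (sqrtC (al * be))^-1.
have ss : s * (s * (al * be)) = 1.
  have := sqrtCK (al * be); rewrite expr2 /s => {3}<-.
  by rewrite mulKf ?mulVf // sqrtC_eq0 mulf_neq0.
have s0 : s != 0 by rewrite invr_eq0 sqrtC_eq0 mulf_neq0.
have sfV : ((s *: f)%R @: Vp = Vp)%VS by rewrite limgZ.
have [h hK hE] := GL_polar_of_lfun hV sfV.
have hSp := GL_polar_Sp hK; have /SpP om_h := hSp; have uh := Sp_unit hSp.
have hVm : h *m w \in Vm by case: hK => _ _ /subvP; apply; apply: mem_lmx.
have hw : h *m w = (s * al) *: w'.
  apply/eqP; rewrite -subr_eq0 -memv0 -pi memv_cap; apply/andP; split; last by rewrite memvB ?memvZ.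
  rewrite -pp; apply/mem_perpP => x; rewrite -sfV => /memv_imgP[y yV ->].
  rewrite omDr omNr -{1}hE // om_h scale_lfunE omZr omZl fw //.
  have -> : s * al * (s * (be * om y w)) = s * (s * (al * be)) * om y w by ring.
  by rewrite ss mul1r subrr.
exists h.
  split=> // d /FoE[d' dm ->]; apply/stabilizesP => //.
  rewrite -[RHS](fF d' dm) -[RHS](limgZ f _ s0); apply: eq_limg => x xF.
  by rewrite lmxE hE // (subvP (flag_sub_Vp dm)).
rewrite UE UE' limg_line lmxE mulmxDr hw hE // scale_lfunE fv scalerA -scalerDr.
have sal0 : s * al != 0 by rewrite mulf_neq0.
apply/eqP; rewrite eqEdim !dim_vline scaler_eq0 (negPf sal0) leqnn andbT -memvE.
by rewrite memvZ ?memv_line.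
Qed.
End Flag.

(** The orthogonal of U carries the flags induced by 0, W, V+ and by V-, the
    annihilator of W, 0; apart from the whole space they have two members each,
    to which U is added. *)
Lemma finite_grassmannian (T : set nat) (E Fo : nat -> {vspace V}) i j :
  (forall d, T d -> d = j) -> (Fo j <= Vp)%VS ->
  \dim (E i) = i -> isotropic (E i) ->
  finitely_many_orbits (GL_polar Vp Vm)
    (double_flag_variety (GL_polar Vp Vm) (flag_stabilizer (GL_polar Vp Vm) T Fo)
       (Sp F n) (flag_stabilizer (Sp F n) [set i]%classic E)).
Proof.
move=> Tj FjV dE iE; have [pp pm pi ps] := polar_perp hV.
pose Fl d := if d is d'.+1 then if d' is 0 then Fo j else Vp else 0%VS.
have mono d e : (d <= e <= 2)%N -> (Fl d <= Fl e)%VS.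
  by case: d e => [|[|[|d]]] [|[|[|e]]] //= _; rewrite ?sub0v.
have perp0 : perp 0 = fullv :> {vspace V}.
  apply/vspaceP => x; rewrite memvf; apply/mem_perpP => u.
  by rewrite memv0 => /eqP->; rewrite om_skew om0r oppr0.
have dual0 : dual_sub (Fl 0%N) = Vm by rewrite /dual_sub perp0 capfv.
have dual2 : dual_sub (Fl 2%N) = 0%VS by rewrite /dual_sub /= pp.
pose L (U : {vspace V}) d := (perp U :&: (Fl d + Vm))%VS.
pose R (U : {vspace V}) d := (perp U :&: (dual_sub (Fl d) + Vp))%VS.
pose form (U : {vspace V}) := @two_short_flags_form _ _ (n + n - i)
  (perp U) (L U 0%N) (L U 1%N) (R U 2%N) (R U 1%N) U.
apply: (finite_orbits_of_codes dE iE (code := form)) => [U iU dU|U U' c iU iU' dU dU' cU cU'].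
  apply: two_short_flags_form_exists; rewrite ?capvSl ?(dim_perpE dU) //.
  - exact: (mono_sum_Vm mono U (isT : (0 < 2)%N)).
  - exact: (mono_dual_Vp mono U (isT : (1 <= 2 <= 2)%N)).
  - exact/isotropicP.
have dp := dim_perpE dU.
have [f [fM [fL0 fL1] [fR2 fR1] fU]] := two_short_flags_form_iso dp cU cU'.
have [||k [kK kF kU]] := flag_fixing_isometry mono erefl erefl iU _ fM fU.
- by rewrite !(@dim_perpE _ i).
- case=> [|[|[|//]]] _ //; split=> //.
    by rewrite dual0 [(Vm + Vp)%VS]addvC ps !capvf.
  by rewrite ps !capvf.
by exists k => //; split=> // d /Tj->; apply: (kF 1%N).
Qed.
End Main.

Local Open Scope classical_set_scope.

Theorem mainTheorem8 (R : realType) (n : nat)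
    (Vp Vm : {vspace 'cV[complex R]_(n + n)})
    (S T : set nat) (E F : nat -> {vspace 'cV[complex R]_(n + n)})
    (hV : polarization Vp Vm)
    (hS : S `<=` [set i | (1 <= i <= n)%N])
    (hT : T `<=` [set j | (1 <= j < n)%N])
    (hE : isotropic_flag S E)
    (hF : flag_in Vp T F)
    (hcase : (S = [set 1%N] \/ S = [set n]) \/
             (exists i j : nat, S = [set i] /\ T = [set j])) :
  let G := Sp (complex R) n in
  let K := GL_polar Vp Vm in
  let P := flag_stabilizer G S E in
  let Q := flag_stabilizer K T F in
  finitely_many_orbits K (double_flag_variety K Q G P).
Proof.
move=> G K P Q; rewrite {}/P {}/Q {}/K {}/G.
have [[dimE _] isoE] := hE; have [[_ Fmono] FV] := hF.
case: hcase => [hS1|[i [j [Si Tj]]]]; last first.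
  rewrite Si; apply: (@finite_grassmannian _ _ _ _ hV _ _ _ i j).
  - by move=> d; rewrite Tj.
  - by apply: FV; rewrite Tj.
  - by apply: dimE; rewrite Si.
  - by apply: isoE; rewrite Si.
have n_gt0 : (0 < n)%N.
  by case: hS1 => S1; [have := hS 1%N | have := hS n]; rewrite S1 => /(_ erefl) /=; lia.
(* The partial flag is completed to a family indexed by 0, ..., n that runs
   from 0 to Vp; below n, members with an index outside T
   repeat the previous one. *)
pose Fl d := if d == n then Vp else (\sum_(t < d.+1 | `[< T t >]) F t)%VS.
have Fl_V d : (Fl d <= Vp)%VS.
  rewrite /Fl; case: ifP => // _; apply/subv_sumP => t /asboolP; exact: FV.
have mono d e : (d <= e <= n)%N -> (Fl d <= Fl e)%VS.
  move=> /andP[de en]; have [E1|ne] := eqVneq e n; first by rewrite {2}/Fl E1 eqxx.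
  have nd : d != n by apply: contraNneq ne => dn; rewrite eqn_leq en -dn de.
  rewrite /Fl (negPf ne) (negPf nd); apply/subv_sumP => t Tt.
  have te : (t < e.+1)%N by apply: leq_trans (ltn_ord t) _.
  exact: (sumv_sup (Ordinal te)).
have Fl0 : Fl 0%N = 0%VS.
  rewrite /Fl eq_sym (negPf (lt0n_neq0 n_gt0)) big_pred0 // => t.
  by apply/negbTE/asboolP => /hT /=; rewrite ord1.
have Fln : Fl n = Vp by rewrite /Fl eqxx.
have FlE d : T d -> exists2 d', (d' <= n)%N & F d = Fl d'.
  move=> Td; have /andP[d0 dn] := hT d Td.
  exists d; first exact: ltnW.
  rewrite /Fl (ltn_eqF dn); apply/eqP; rewrite eqEsubv; apply/andP; split.
    by apply: (sumv_sup ord_max) => //; apply/asboolP.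
  by apply/subv_sumP => t /asboolP Tt; apply: Fmono => //; rewrite -ltnS.
case: hS1 => S1; rewrite S1.
  apply: (finite_line hV mono Fln FlE); first by apply: dimE; rewrite S1.
  by apply: isoE; rewrite S1.
apply: (finite_lagrangian hV mono Fl0 Fln FlE); first by apply: dimE; rewrite S1.
by apply: isoE; rewrite S1.
Qed.
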